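(* Let $d:=d_1d_2$ and suppose $a=x_0+\epsilon$, where $x_0\in\mathbb{R}^{dn}$ and $\epsilon\in\mathbb{R}^{dn}$ is a vector of independent sub-Gaussian random variables with mean zero and variance $\sigma^2$. Assume $\min_{l(i,j)\in\mathcal{E}}w_{ij}\ge\frac12$. Let $\hat{x}$ be the solution of $$\min_{x\in\mathbb{R}^{dn}}\ \frac12\|x-a\|^2+\gamma_1\sum_{l(i,j)\in\mathcal{E}}w_{ij}\|D^{l(i,j)}x\|+\gamma_2\sum_{i=1}^n\|\mathcal{M}^ix\|_*.$$ Let $\kappa_0$ be the number of connected components and $B\in\mathbb{R}^{n\times|\mathcal{E}|}$ the incidence matrix of the graph $\mathcal{G}=([n],\mathcal{E})$. If $\gamma_1\ge\frac{4\sigma}{\sigma_{\min}(B)}\sqrt{d\log(d|\mathcal{E}|)}$, then $$\frac{1}{2dn}\|\hat{x}-x_0\|^2\le\sigma^2\left[\frac{\kappa_0}{n}+\sqrt{\frac{\kappa_0\log(dn)}{dn^2}}\right]+\frac{\gamma_1}{2dn}\sum_{l(i,j)\in\mathcal{E}}(1+2w_{ij})\|D^{l(i,j)}x_0\|+\gamma_2\left[\frac{\sigma}{n^{1/4}}+\frac{1}{dn}\sum_{i=1}^n\|\mathcal{M}^ix_0\|_*\right]$$ holds with probability at least $$1-\frac{2}{d|\mathcal{E}|}-2\exp\left(-\frac{\sqrt{d^3n}}{2}\right)-\exp\left\{-\min\left(c_1\log(dn),\ c_2\sqrt{d\kappa_0\log(dn)}\right)\right\},$$ where $c_1,c_2$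 are positive constants.
   Context: Assume $d_1\ge d_2$, $\gamma_1,\gamma_2>0$. $\mathcal{G}=([n],\mathcal{E})$ is an undirected graph on $[n]=\{1,\dots,n\}$; $l(i,j)\in\mathcal{E}$ ($i<j$) denotes the edge joining $i$ and $j$, with positive weight $w_{ij}$. $D^{l(i,j)}:=(e_i^{\top}-e_j^{\top})\otimes I_d\in\mathbb{R}^{d\times dn}$, with $e_i$ the $i$-th standard basis vector of $\mathbb{R}^n$ and $\otimes$ the Kronecker product. $\mathcal{M}^i:\mathbb{R}^{dn}\to\mathbb{R}^{d_1\times d_2}$ is the linear map taking the $i$-th length-$d$ block of $x$ and reshaping it (column by column) into a $d_1\times d_2$ matrix. $\|\cdot\|$ is the Euclidean norm, $\|\cdot\|_*$ the nuclear norm. The incidence matrix $B$ is the oriented one: the column indexed by $l(i,j)$ is $e_i-e_j$. $\sigma_{\min}(Z)$ denotes the minimum nonzero singular value of $Z$. A random variable $x\in\mathbb{R}$ is called sub-Gaussian with mean zero and variance $\sigma^2$ if $\mathbb{E}[\exp(sx)]\le\exp(\sigma^2s^2/2)$ for every $s\in\mathbb{R}$. *)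

(* Defs.v *)
From HB Require Import structures.
From mathcomp Require Import all_boot all_order all_algebra.
From mathcomp Require Import all_classical all_reals all_analysis.
From mathcomp Require Import polyrcf mxtens.

Set Implicit Arguments.
Unset Strict Implicit.
Unset Printing Implicit Defensive.

Import Order.TTheory GRing.Theory Num.Theory.
Import numFieldNormedType.Exports.

Local Open Scope classical_set_scope.
Local Open Scope ring_scope.

(* The norm that MathComp-Analysis puts on matrices is the max norm, hence a
   separate Euclidean norm. *)
Definition enorm (R : realType) (m : nat) (u : 'cV[R]_m) : R :=
  Num.sqrt (\sum_i u i 0 ^+ 2).

(* Square roots of the eigenvalues of A^T A, repeated according to
   multiplicity; zeros are included, so there are always n entries. *)
Definition singular_values (R : realType) (m n : nat) (A : 'M[R]_(m, n)) :
    seq R :=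
  let p := char_poly (A^T *m A) in
  flatten [seq nseq (mup x p) (Num.sqrt x) | x <- rootsR p].

Definition nuclear_norm (R : realType) (m n : nat) (A : 'M[R]_(m, n)) : R :=
  \sum_(s <- singular_values A) s.

(* Minimum nonzero singular value; the default 0 is reached only if A = 0. *)
Definition sigma_min (R : realType) (m n : nat) (A : 'M[R]_(m, n)) : R :=
  head 0 (sort <=%R [seq s <- singular_values A | s != 0]).

Definition edges (n : nat) (e : rel 'I_n) : {set 'I_n * 'I_n} :=
  [set l : 'I_n * 'I_n | (l.1 < l.2)%N && e l.1 l.2]%SET.

Definition incidence (R : realType) (n : nat) (e : rel 'I_n) :
    'M[R]_(n, #|edges e|) :=
  \matrix_(k, l) ((k == (enum_val l).1)%:R - (k == (enum_val l).2)%:R).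

(* Vectors of R^(dn) are 'cV_(n * d): n consecutive blocks of length d, the
   k-th entry of block i having index mxtens_index (i, k) = i * d + k. *)
Definition edge_diff (R : realType) (n d : nat) (l : 'I_n * 'I_n) :
    'M[R]_(1 * d, n * d) :=
  (delta_mx 0 l.1 - delta_mx 0 l.2 : 'rV[R]_n) *t (1%:M : 'M[R]_d).

(* Column-by-column reshaping: entry (r, c) is at position c * d1 + r of the
   block. *)
Definition block_mat (R : realType) (n d1 d2 : nat) (i : 'I_n)
    (x : 'cV[R]_(n * (d1 * d2))) : 'M[R]_(d1, d2) :=
  \matrix_(r, c)
    x (mxtens_index (i, cast_ord (mulnC d2 d1) (mxtens_index (c, r)))) 0.

Definition objective (R : realType) (n d1 d2 : nat) (e : rel 'I_n)
    (w : 'I_n -> 'I_n -> R) (gamma1 gamma2 : R)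
    (a x : 'cV[R]_(n * (d1 * d2))) : R :=
  2^-1 * enorm (x - a) ^+ 2
  + gamma1 * (\sum_(l in edges e)
                w l.1 l.2 * enorm (edge_diff R (d1 * d2) l *m x))
  + gamma2 * (\sum_(i < n) nuclear_norm (block_mat i x)).

Definition minimizer (T : Type) (R : realType) (f : T -> R) (x : T) : Prop :=
  forall y, f x <= f y.

Definition mutually_independent (disp : measure_display)
    (Omega : measurableType disp) (R : realType) (P : probability Omega R)
    (I : finType) (X : I -> {RV P >-> R}) : Prop :=
  forall (J : {set I}) (A : I -> set R), (forall i, measurable (A i)) ->
    P (\bigcap_(i in [set` J]) (X i @^-1` A i))
      = (\prod_(i in J) P (X i @^-1` A i))%E.

Definition sub_gaussian (disp : measure_display)
    (Omega : measurableType disp) (R : realType) (P : probability Omega R)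
    (X : {RV P >-> R}) (sigma : R) : Prop :=
  forall s : R,
    ('E_P[fun om => expR (s * X om)] <= (expR (sigma ^+ 2 * s ^+ 2 / 2))%:E)%E.

(* Main.v *)
Require Import Defs.
From HB Require Import structures.
From mathcomp Require Import all_boot all_order all_algebra.
From mathcomp Require Import polyrcf mxtens complex.
From mathcomp Require Import all_classical all_reals all_analysis.
From mathcomp Require Import measurable_realfun.
From mathcomp Require Import ring lra.

Set Implicit Arguments.
Unset Strict Implicit.
Unset Printing Implicit Defensive.

Import Order.TTheory GRing.Theory Num.Theory.
Import numFieldNormedType.Exports.

Local Open Scope classical_set_scope.
Local Open Scope ring_scope.

(* By strong convexity, the minimizer xh of 1/2 |x - a|^2 + g x with
   a = x0 + eps satisfies |xh - x0|^2 <= <eps, xh - x0> + g x0 - g xh; the full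
   square on the left, instead of a half, leaves room for the noise term.
   Let B be the incidence matrix. The projection onto the functions constant on
   connected components and a pseudo-inverse M of B give I = Pi + B M, so that,
   with h = xh - x0,
   - <Pi eps, h> <= 1/2 |Pi eps|^2 + 1/2 |h|^2, where |Pi eps|^2 is a sum of
     d * kappa0 squares with a chi-square type tail;
   - <B M eps, h> = <M eps, B^T h> <= sum_l |(M eps)_l| |D_l h|, where the rows
     of M have norm at most 1 / sigma_min(B), so that with high probability the
     blocks of M eps are bounded by gamma1 / 2. As w >= 1/2, the resulting
     gamma1 / 2 |D_l xh| is absorbed by the penalty.
   The nuclear norm enters only through its convexity and its sign. *)

(** * Real spectral theorem and singular values *)

(** The coordinates of [Pi eps] need not be independent, so no product formula is available for the
    exponential of their squares. What survives the orthonormal change of coordinates is the bound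
    on the Laplace transform of every linear form, and the chi-square type tail is derived from that
    bound alone. Independence serves to establish it for linear forms in eps; as it is given for
    events, it must first be carried over to expectations of products.

    The estimator is given only as a pointwise minimizer, so the event in the conclusion must be
    shown measurable. Minimizers of such a strongly convex objective depend on the data in a
    1-Lipschitz way, which makes the error a Lipschitz function of finitely many random variables.

    Singular values are read off a characteristic polynomial. The real spectral theorem ties them to
    an orthonormal basis, from which come both the dual description of the nuclear norm, hence its
    convexity, and the pseudo-inverse with its row bound. *)

Lemma mulmx_tr_ge0 (R : realDomainType) n (x : 'rV[R]_n) : 0 <= (x *m x^T) 0 0.
Proof. by rewrite mxE sumr_ge0// => i _; rewrite mxE -expr2 sqr_ge0. Qed.

Lemma mulmx_tr_eq0 (R : realDomainType) n (x : 'rV[R]_n) :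
  ((x *m x^T) 0 0 == 0) = (x == 0).
Proof.
apply/idP/eqP => [|->]; last by rewrite mul0mx mxE.
rewrite mxE psumr_eq0; last by move=> i _; rewrite mxE -expr2 sqr_ge0.
move=> /allP h; apply/rowP => i; rewrite mxE.
by have := h i (mem_index_enum _); rewrite /= mxE -expr2 sqrf_eq0 => /eqP.
Qed.

(** A complex eigenvector x + iy exists for some eigenvalue a + ib. Comparing x S y^T with y S x^T,
    equal by symmetry, gives b (|x|^2 + |y|^2) = 0, hence b = 0, and whichever of x, y is nonzero is
    a real eigenvector. *)
Lemma symmetric_eigenvector (R : rcfType) n (S : 'M[R]_n.+1) : S^T = S ->
  exists (a : R) (v : 'rV[R]_n.+1), v != 0 /\ v *m S = a *: v.
Proof.
move=> symS.
pose f := @real_complex_def R (Phant R).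
have [a /eigenvalueP[v vS v0]] :=
  @eigenvalue_closed (complex R) n.+1 (map_mx f S) isT.
case: a vS => a b vS.
pose x := map_mx (@complex.Re R) v; pose y := map_mx (@complex.Im R) v.
have ReM (u z : complex R) : complex.Re (u * z) =
  complex.Re u * complex.Re z - complex.Im u * complex.Im z.
  by case: u; case: z.
have ImM (u z : complex R) : complex.Im (u * z) =
  complex.Re u * complex.Im z + complex.Im u * complex.Re z.
  by case: u; case: z.
have xS : x *m S = a *: x - b *: y.
  apply/rowP => j; move/rowP/(_ j)/(congr1 (@complex.Re R)) : vS.
  rewrite !mxE raddf_sum ReM /= => <-; apply: eq_bigr => k _.
  by rewrite !mxE ReM /= mulr0 subr0.
have yS : y *m S = a *: y + b *: x.
  apply/rowP => j; move/rowP/(_ j)/(congr1 (@complex.Im R)) : vS.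
  rewrite !mxE raddf_sum ImM /= => <-; apply: eq_bigr => k _.
  by rewrite !mxE ImM /= mulr0 add0r.
have xy0 : x != 0 \/ y != 0.
  have [x0|] := eqVneq x 0; last by left.
  right; apply: contraNneq v0 => y0; apply/eqP/rowP => j.
  move/rowP/(_ j) : x0; move/rowP/(_ j) : y0; rewrite !mxE.
  by case: (v 0 j) => p q /= -> ->.
have xy : x *m y^T = y *m x^T.
  by apply/matrixP => i j; rewrite !mxE; apply: eq_bigr => k _;
    rewrite !mxE !ord1 mulrC.
have b0 : b = 0.
  have : x *m S *m y^T = y *m S *m x^T.
    transitivity (x *m S *m y^T)^T; last by rewrite !trmx_mul trmxK symS mulmxA.
    by apply/matrixP => i j; rewrite [RHS]mxE !ord1.
  rewrite xS yS mulmxBl mulmxDl -!scalemxAl xy => /addrI/eqP.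
  rewrite eq_sym -subr_eq0 opprK -scalerDr scaler_eq0 => /orP[/eqP//|].
  move=> /eqP/matrixP/(_ 0 0)/eqP; rewrite [X in X == _]mxE [X in _ == X]mxE.
  rewrite paddr_eq0 ?mulmx_tr_ge0// !mulmx_tr_eq0.
  by case: xy0 => /negPf ->; rewrite ?andbF.
move: xS yS; rewrite b0 !scale0r subr0 addr0 => xS yS.
by case: xy0; [exists a, x|exists a, y].
Qed.

(* Householder reflection exchanging the first basis vector and v. *)
Lemma orthogonal_with_row0 (R : realFieldType) n (v : 'rV[R]_n.+1) :
  (v *m v^T) 0 0 = 1 ->
  exists H : 'M[R]_n.+1, [/\ H^T = H, H *m H = 1%:M & delta_mx 0 0 *m H = v].
Proof.
move=> v1; pose e0 : 'rV[R]_n.+1 := delta_mx 0 0.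
have [<-|ve] := eqVneq e0 v.
  by exists 1%:M; rewrite trmx1 !mulmx1.
pose u := e0 - v; pose N := (u *m u^T) 0 0.
have N0 : N != 0 by rewrite /N mulmx_tr_eq0 subr_eq0.
have uuT : u *m u^T = N%:M by rewrite [LHS]mx11_scalar.
(* For unit vectors, |e0 - v|^2 = 2 (1 - <e0, v>) = 2 <e0, u>, so the reflection along u maps e0 to
   e0 - u = v. *)
have e0u : e0 *m u^T = (N / 2)%:M.
  have e0e0 : e0 *m e0^T = 1%:M.
    by rewrite trmx_delta mul_delta_mx; apply/matrixP => i j; rewrite !mxE !ord1.
  have ve0 : v *m e0^T = e0 *m v^T.
    by apply/matrixP => i j; rewrite !mxE; apply: eq_bigr => k _;
      rewrite !mxE !ord1 mulrC.
  have vv : v *m v^T = 1%:M by rewrite [LHS]mx11_scalar v1.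
  have -> : N = 2 * (1 - (e0 *m v^T) 0 0).
    rewrite /N /u linearB /= mulmxBl !mulmxBr e0e0 vv ve0 !mxE eqxx /=.
    by rewrite mulr1n; ring.
  rewrite linearB /= mulmxBr e0e0; apply/matrixP => i j.
  by rewrite !mxE !ord1 eqxx !mulr1n; field.
exists (1%:M - (2 / N) *: (u^T *m u)); split.
- by rewrite linearB /= trmx1 linearZ /= trmx_mul trmxK.
- move: u N N0 uuT {e0u ve} => u N N0 uuT; set c := 2 / N.
  have cN : c * (c * N) = 2 * c by rewrite /c; field.
  clearbody c; rewrite mulmxBr mulmx1 mulmxBl mul1mx -scalemxAl -scalemxAr.
  rewrite mulmxA -[u^T *m u *m u^T]mulmxA uuT mul_mx_scalar -scalemxAl !scalerA.
  by rewrite cN mulr_natl -scalerMnl mulr2n opprB addrK subrK.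
- rewrite mulmxBr mulmx1 -scalemxAr mulmxA e0u mul_scalar_mx scalerA.
  by rewrite (_ : 2 / N * (N / 2) = 1) ?scale1r /u; [rewrite opprB addrC subrK|field].
Qed.

(** Deflation: conjugating by a reflection whose first row is a unit eigenvector makes the first row
    of the matrix a multiple of the first basis vector, by symmetry also the first column, and the
    induction runs on the remaining block. *)
Lemma real_spectral (R : rcfType) n (S : 'M[R]_n) : S^T = S ->
  exists (V : 'M[R]_n) (d : 'rV[R]_n),
    V *m V^T = 1%:M /\ V *m S *m V^T = diag_mx d.
Proof.
elim: n S => [|n IH] S symS.
  by exists 1%:M, 0; split; apply/matrixP => -[].
have [a [v0 [v0n0 v0S]]] := symmetric_eigenvector symS.
pose v := (Num.sqrt ((v0 *m v0^T) 0 0))^-1 *: v0.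
have q0 : 0 < (v0 *m v0^T) 0 0.
  by rewrite lt_neqAle mulmx_tr_ge0 eq_sym mulmx_tr_eq0 v0n0.
have v1 : (v *m v^T) 0 0 = 1.
  rewrite /v linearZ /= -scalemxAl -scalemxAr scalerA mxE -invfM -expr2.
  by rewrite sqr_sqrtr ?(ltW q0)// mulVf// gt_eqF.
have vS : v *m S = a *: v by rewrite /v -scalemxAl v0S scalerA mulrC -scalerA.
have [H [symH HH e0H]] := orthogonal_with_row0 v1.
pose T : 'M[R]_(1 + n) := H *m S *m H.
have symT : T^T = T by rewrite /T !trmx_mul symH symS mulmxA.
have T0 j : T 0 j = a * (0 == j)%:R.
  have : delta_mx 0 0 *m T = a *: delta_mx 0 0 :> 'rV_n.+1.
    by rewrite /T !mulmxA e0H vS -scalemxAl -e0H -mulmxA HH mulmx1.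
  rewrite -rowE => /rowP/(_ j).
  by rewrite !mxE eqxx /= eq_sym => ->.
have Tul : ulsubmx T = a%:M.
  apply/rowP => j; rewrite -(block_mxEul _ (ursubmx T) (dlsubmx T) (drsubmx T)).
  rewrite submxK ord1 (_ : lshift n 0 = 0 :> 'I_(1 + n)); last exact/val_inj.
  by rewrite T0 mulr1 mxE mulr1n.
have Tur : ursubmx T = 0.
  apply/rowP => j.
  rewrite -(block_mxEur (ulsubmx T) _ (dlsubmx T) (drsubmx T)) submxK [RHS]mxE.
  have -> : lshift n 0 = 0 :> 'I_(1 + n) by apply/val_inj.
  by rewrite T0 mulr0.
have Tdl : dlsubmx T = 0.
  by rewrite -[LHS]trmxK trmx_dlsub symT Tur trmx0.
have [V' [d' [V'V' V'T]]] : exists (V : 'M[R]_n) (d : 'rV[R]_n),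
    V *m V^T = 1%:M /\ V *m drsubmx T *m V^T = diag_mx d.
  by apply: IH; rewrite trmx_drsub symT.
pose W : 'M[R]_(1 + n) := block_mx 1%:M 0 0 V'.
have WW : W *m W^T = 1%:M.
  rewrite /W tr_block_mx mulmx_block !trmx1 !trmx0.
  by rewrite !(mulmx0, mul0mx, mulmx1) !addr0 add0r V'V' -scalar_mx_block.
exists (W *m H), (row_mx a%:M d'); split.
  by rewrite trmx_mul symH mulmxA -[W *m H *m H]mulmxA HH mulmx1.
have -> : W *m H *m S *m (W *m H)^T = W *m T *m W^T.
  by rewrite trmx_mul symH /T !mulmxA.
rewrite -[T]submxK Tul Tur Tdl /W tr_block_mx !mulmx_block !trmx1 !trmx0.
rewrite !(mulmx0, mul0mx, mulmx1, mul1mx, addr0, add0r) V'T.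
have E : diag_mx (row_mx (a%:M : 'M[R]_1) d') = block_mx a%:M 0 0 (diag_mx d').
  by rewrite diag_mx_row; congr block_mx; apply/rowP => j;
    rewrite !mxE !ord1 eqxx.
exact: esym E.
Qed.

Lemma sum_mul_le_sqrt (R : rcfType) (I : finType) (a b : I -> R) :
  \sum_i a i * b i <= Num.sqrt (\sum_i a i ^+ 2) * Num.sqrt (\sum_i b i ^+ 2).
Proof.
set A := \sum_i a i ^+ 2; set B := \sum_i b i ^+ 2; set C := \sum_i a i * b i.
have A0 : 0 <= A by apply: sumr_ge0 => i _; exact: sqr_ge0.
have B0 : 0 <= B by apply: sumr_ge0 => i _; exact: sqr_ge0.
have [Bz|Bn0] := eqVneq B 0.
  have b0 i : b i = 0.
    move/eqP : Bz; rewrite psumr_eq0; last by move=> *; exact: sqr_ge0.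
    by move=> /allP/(_ i (mem_index_enum _)); rewrite sqrf_eq0 => /eqP.
  by rewrite Bz sqrtr0 mulr0 /C big1// => i _; rewrite b0 mulr0.
(* The factor B turns the Cauchy-Schwarz gap into a sum of squares; this is why B = 0 was set
   apart. *)
have : 0 <= B * (A * B - C ^+ 2).
  have -> : B * (A * B - C ^+ 2) = \sum_i (B * a i - C * b i) ^+ 2.
    under [RHS]eq_bigr => i _.
      rewrite (_ : _ ^+ 2 = B ^+ 2 * a i ^+ 2 - 2 * B * C * (a i * b i)
        + C ^+ 2 * b i ^+ 2); last by ring.
      over.
    rewrite big_split sumrB -!mulr_sumr -/A -/B -/C /=; ring.
  by apply: sumr_ge0 => i _; exact: sqr_ge0.
rewrite pmulr_rge0 ?lt_neqAle ?B0 1?eq_sym ?Bn0// subr_ge0 -sqrtrM// => CAB.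
by rewrite (le_trans (ler_norm _))// -sqrtr_sqr ler_wsqrtr.
Qed.

Lemma char_poly_orthogonal_conj (R : comUnitRingType) n (V D : 'M[R]_n) :
  V^T *m V = 1%:M -> char_poly (V^T *m D *m V) = char_poly D.
Proof.
move=> VV; rewrite /char_poly /char_poly_mx.
pose W := map_mx polyC V.
have WW : W^T *m W = 1%:M by rewrite /W map_trmx -map_mxM VV map_mx1.
have -> : 'X%:M - map_mx polyC (V^T *m D *m V) =
    W^T *m ('X%:M - map_mx polyC D) *m W.
  rewrite mulmxBr mulmxBl !map_mxM map_trmx; congr (_ - _).
  by rewrite mul_mx_scalar -scalemxAl -map_trmx WW scalemx1.
by rewrite !det_mulmx mulrC mulrA -det_mulmx (mulmx1C WW) det1 mul1r.
Qed.

(* The rows of V are right singular vectors, d lists the squared singular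
   values. *)
Lemma right_singular_basis (R : realType) m n (A : 'M[R]_(m, n)) :
  exists (V : 'M[R]_n) (d : 'rV[R]_n),
  [/\ V *m V^T = 1%:M, V *m (A^T *m A) *m V^T = diag_mx d, forall j, 0 <= d 0 j
    & perm_eq (singular_values A) [seq Num.sqrt (d 0 j) | j <- enum 'I_n]].
Proof.
have sym : (A^T *m A)^T = A^T *m A by rewrite trmx_mul trmxK.
have [V [d [VV VSV]]] := real_spectral sym.
have VTV := mulmx1C VV.
have d_ge0 j : 0 <= d 0 j.
  have -> : d 0 j = diag_mx d j j by rewrite mxE eqxx mulr1n.
  rewrite -VSV (_ : V *m _ *m _ = (A *m V^T)^T *m (A *m V^T)).
    by rewrite mxE sumr_ge0// => i _; rewrite mxE -expr2 sqr_ge0.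
  by rewrite trmx_mul trmxK !mulmxA.
exists V, d; split => //.
have pE : char_poly (A^T *m A) = \prod_(y <- [seq d 0 j | j <- enum 'I_n]) ('X - y%:P).
  have -> : A^T *m A = V^T *m diag_mx d *m V.
    by rewrite -VSV !mulmxA VTV mul1mx -mulmxA VTV mulmx1.
  rewrite char_poly_orthogonal_conj// char_poly_trig ?diag_mx_is_trig//.
  rewrite big_map big_enum /=.
  by apply: eq_bigr => j _; rewrite mxE eqxx mulr1n.
rewrite /singular_values map_comp.
set p := char_poly _ in pE *; set s := [seq d 0 j | j <- _] in pE *.
have -> : flatten [seq nseq (mup x p) (Num.sqrt x) | x <- rootsR p] =
    map Num.sqrt (flatten [seq nseq (mup x p) x | x <- rootsR p]).
  by rewrite map_flatten -map_comp; congr flatten; apply: eq_map => x /=;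
    rewrite map_nseq.
(* The two lists are compared by counting: [rootsR] lists each root once, so either count is
   [mup x p], which is 0 off the roots. *)
apply: perm_map; apply/allP => x _; apply/eqP.
rewrite /= count_flatten -map_comp.
have p0 : p != 0 by rewrite monic_neq0// char_poly_monic.
have -> : count_mem x s = mup x p by rewrite pE mu_prod_XsubC.
rewrite sumnE big_map.
under eq_bigr do rewrite /= count_nseq.
have [xr|xr] := boolP (x \in rootsR p).
  rewrite (bigD1_seq x)//= ?eqxx ?mul1n ?big1 ?addn0 ?uniq_roots//.
  by move=> i ix; rewrite (negPf ix).
rewrite big_seq big1; last first.
  by move=> i ir; rewrite /= (negPf (memPn xr _ ir)).
by rewrite mupNroot//; move: xr; rewrite -roots_on_rootsR// in_itv.
Qed.

(** * Nuclear norm as the dual of the operator norm *)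

Lemma nuclear_norm_ge0 (R : realType) m n (A : 'M[R]_(m, n)) :
  0 <= nuclear_norm A.
Proof.
have [V [d [_ _ _ ss]]] := right_singular_basis A.
by rewrite /nuclear_norm (perm_big _ ss) big_map sumr_ge0// => j _; exact: sqrtr_ge0.
Qed.

(** The unit ball of the operator norm, phrased without defining that norm. *)
Definition contraction (R : realDomainType) m n (Z : 'M[R]_(m, n)) :=
  forall x : 'cV[R]_n, ((Z *m x)^T *m (Z *m x)) 0 0 <= (x^T *m x) 0 0.

(** In the basis of right singular vectors v_j the trace is the sum of <A v_j, Z v_j>, and |A v_j|
    is the j-th singular value while |Z v_j| <= 1. *)
Lemma mxtrace_contraction_le (R : realType) m n (A Z : 'M[R]_(m, n)) :
  contraction Z -> \tr (A^T *m Z) <= nuclear_norm A.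
Proof.
have [V [d [VV VAV d0 ss]]] := right_singular_basis A.
move=> cZ; rewrite /nuclear_norm (perm_big _ ss) big_map big_enum /=.
rewrite -[Z]mulmx1 -(mulmx1C VV) !mulmxA mxtrace_mulC /mxtrace.
apply: ler_sum => j _.
have -> : V *m (A^T *m Z *m V^T) = (A *m V^T)^T *m (Z *m V^T).
  by rewrite trmx_mul trmxK !mulmxA.
rewrite mxE; under eq_bigr do rewrite mxE.
apply: le_trans (sum_mul_le_sqrt _ _) _.
rewrite -[leRHS]mulr1; apply: ler_pM; rewrite ?sqrtr_ge0//.
  rewrite ler_wsqrtr// (_ : d 0 j = diag_mx d j j); last first.
    by rewrite mxE eqxx mulr1n.
  rewrite -VAV (_ : V *m _ *m _ = (A *m V^T)^T *m (A *m V^T)).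
    by rewrite mxE; under [leRHS]eq_bigr do rewrite mxE -expr2.
  by rewrite trmx_mul trmxK !mulmxA.
rewrite -sqrtr1 ler_wsqrtr//.
have colZ : Z *m col j V^T = col j (Z *m V^T) by rewrite !colE mulmxA.
have le_col : \sum_i (Z *m V^T) i j ^+ 2 <= ((col j V^T)^T *m col j V^T) 0 0.
  apply: le_trans (cZ _); rewrite colZ mxE; apply: ler_sum => i _.
  by rewrite [X in X * _]mxE [col _ _ _ _]mxE expr2.
apply: (le_trans le_col); rewrite le_eqVlt; apply/orP; left; apply/eqP.
transitivity ((V *m V^T) j j); last by rewrite VV mxE eqxx.
by rewrite !mxE; apply: eq_bigr => i _; rewrite !mxE.
Qed.

Lemma mxtrace_contraction_eq (R : realType) m n (A : 'M[R]_(m, n)) :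
  exists2 Z : 'M[R]_(m, n), contraction Z & \tr (A^T *m Z) = nuclear_norm A.
Proof.
have [V [d [VV VAV d0 ss]]] := right_singular_basis A.
(* As 0^-1 = 0, the witness A V^T diag(f) V is the partial isometry of the polar decomposition of A,
   vanishing on the kernel of A. *)
pose f := \row_j (Num.sqrt (d 0 j))^-1.
have VTV := mulmx1C VV.
have [X [XX AX]] : exists X, X^T *m X = diag_mx d /\ A = X *m V.
  exists (A *m V^T); rewrite -VAV trmx_mul trmxK !mulmxA.
  by rewrite -[A *m _ *m V]mulmxA VTV mulmx1.
exists (X *m (diag_mx f *m V)) => [x|].
  rewrite -!mulmxA; set y := V *m x; set z := diag_mx f *m y.
  have -> : (x^T *m x) 0 0 = \sum_j y j 0 ^+ 2.
    have -> : x^T *m x = y^T *m y.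
      by rewrite trmx_mul -mulmxA [V^T *m _]mulmxA VTV mul1mx.
    by rewrite mxE; apply: eq_bigr => j _; rewrite mxE.
  have -> : (X *m z)^T *m (X *m z) = z^T *m diag_mx d *m z.
    by rewrite -XX trmx_mul !mulmxA.
  clearbody y; rewrite mul_mx_diag mxE; apply: ler_sum => j _.
  rewrite /z mul_diag_mx !mxE.
  have [->|dj0] := eqVneq (d 0 j) 0.
    by rewrite sqrtr0 invr0 !(mul0r, mulr0) sqr_ge0.
  set q := Num.sqrt (d 0 j); have q0 : q != 0.
    by rewrite sqrtr_eq0 -ltNge lt_neqAle eq_sym dj0 d0.
  rewrite -[d 0 j]sqr_sqrtr// -/q.
  by rewrite (_ : _ * _ = y j 0 ^+ 2)//; field.
have -> : \tr (A^T *m (X *m (diag_mx f *m V))) = \tr (X^T *m X *m diag_mx f).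
  rewrite AX trmx_mul !mulmxA mxtrace_mulC !mulmxA VV mul1mx.
  by rewrite -mulmxA.
rewrite XX /nuclear_norm (perm_big _ ss) big_map big_enum /=.
rewrite /mxtrace; apply: eq_bigr => j _.
rewrite mul_diag_mx !mxE eqxx mulr1n.
have [->|dj0] := eqVneq (d 0 j) 0; first by rewrite sqrtr0 mul0r.
rewrite -{1}[d 0 j]sqr_sqrtr// expr2 mulfK//.
by rewrite sqrtr_eq0 -ltNge lt_neqAle eq_sym dj0 d0.
Qed.

(** A maximum of linear functionals is convex: the contraction attaining the value at the
    combination is tested against A and B separately. *)
Lemma nuclear_norm_convex (R : realType) m n (A B : 'M[R]_(m, n)) (s t : R) :
  0 <= s -> 0 <= t ->
  nuclear_norm (s *: A + t *: B) <= s * nuclear_norm A + t * nuclear_norm B.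
Proof.
move=> s0 t0; have [Z cZ <-] := mxtrace_contraction_eq (s *: A + t *: B).
rewrite linearD /= !linearZ /= mulmxDl mxtraceD -!scalemxAl !mxtraceZ.
by apply: lerD; apply: ler_wpM2l => //; exact: mxtrace_contraction_le.
Qed.

(** * Smallest nonzero singular value and pseudo-inverse *)

Lemma sigma_min_le (R : realType) m n (A : 'M[R]_(m, n)) s :
  s \in singular_values A -> s != 0 -> sigma_min A <= s.
Proof.
move=> sA s0; rewrite /sigma_min.
have : s \in sort <=%R [seq s <- singular_values A | s != 0].
  by rewrite mem_sort mem_filter s0.
have := sort_sorted (@le_total _ R) [seq s <- singular_values A | s != 0].
case: sort => //= x l xl; rewrite inE => /orP[/eqP->//|sl].
by have /allP/(_ _ sl) := order_path_min le_trans xl.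
Qed.

Lemma sigma_min_ge0 (R : realType) m n (A : 'M[R]_(m, n)) : 0 <= sigma_min A.
Proof.
rewrite /sigma_min.
have : {in sort <=%R [seq s <- singular_values A | s != 0], forall s, 0 <= s}.
  move=> s; rewrite mem_sort mem_filter => /andP[s0 sA].
  have [V [d [_ _ _ ss]]] := right_singular_basis A.
  by move: sA; rewrite (perm_mem ss) => /mapP[j _ ->]; exact: sqrtr_ge0.
by case: sort => //= x l; apply; rewrite mem_head.
Qed.

Lemma sigma_min_gt0 (R : realType) m n (A : 'M[R]_(m, n)) s :
  s \in singular_values A -> s != 0 -> 0 < sigma_min A.
Proof.
move=> sA s0; rewrite /sigma_min.
have : s \in sort <=%R [seq s <- singular_values A | s != 0].
  by rewrite mem_sort mem_filter s0.
have : forall x, x \in sort <=%R [seq s <- singular_values A | s != 0] -> 0 < x.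
  move=> x; rewrite mem_sort mem_filter => /andP[x0].
  have [V [d [_ _ d0 ss]]] := right_singular_basis A.
  rewrite (perm_mem ss) => /mapP[j _ xj].
  by move: x0; rewrite xj lt_neqAle sqrtr_ge0 eq_sym => ->.
by case: sort => //= x l /(_ x (mem_head _ _)).
Qed.

(** M is the Moore-Penrose inverse (B^T B)^+ B^T. The squared norm of its row l is the diagonal
    entry l of M M^T = (B^T B)^+, an average of the inverse eigenvalues with weights [V j l ^+ 2]
    summing to 1, where the inverse of 0 is 0. *)
Lemma bounded_pseudo_inverse (R : realType) n m (B : 'M[R]_(n, m)) :
  exists M : 'M[R]_(m, n),
  [/\ (B *m M)^T = B *m M, B *m M *m B = B
    & forall l, \sum_k M l k ^+ 2 <= (sigma_min B) ^- 2].
Proof.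
have [V [d [VV VBV d0 ss]]] := right_singular_basis B.
pose f := \row_j (d 0 j)^-1.
have VTV := mulmx1C VV.
have [X [XX BX]] : exists X, X^T *m X = diag_mx d /\ B = X *m V.
  exists (B *m V^T); rewrite -VBV trmx_mul trmxK !mulmxA.
  by rewrite -[B *m _ *m V]mulmxA VTV mulmx1.
exists (V^T *m diag_mx f *m X^T).
have BM : B *m (V^T *m diag_mx f *m X^T) = X *m diag_mx f *m X^T.
  by rewrite BX !mulmxA -[X *m V *m _]mulmxA VV mulmx1.
split.
- by rewrite BM !trmx_mul trmxK tr_diag_mx mulmxA.
- rewrite BM [in LHS]BX -!mulmxA [X^T *m _]mulmxA XX [RHS]BX !mulmxA; congr (_ *m V).
  apply/matrixP => i j; rewrite !mul_mx_diag !mxE.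
  (* At a zero eigenvalue the inverse is lost, but column j of X has squared norm [d 0 j] and so
     vanishes. *)
  have [dj0|dj0] := eqVneq (d 0 j) 0; last by rewrite mulfVK.
  rewrite dj0 mulr0.
  have : \sum_i X i j ^+ 2 = 0.
    transitivity ((X^T *m X) j j); last by rewrite XX mxE dj0 mul0rn.
    by rewrite mxE; apply: eq_bigr => k _; rewrite mxE.
  move/eqP; rewrite psumr_eq0; last by move=> k _; exact: sqr_ge0.
  move=> /allP/(_ i (mem_index_enum _)); rewrite sqrf_eq0 => /eqP.
  by move=> ->.
- move=> l; set M := _ *m X^T.
  have MM : M *m M^T = V^T *m diag_mx f *m V.
    rewrite /M !trmx_mul trmxK tr_diag_mx trmxK -!mulmxA [X^T *m _]mulmxA XX.
    congr (_ *m _); rewrite !mulmxA; congr (_ *m V).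
    apply/matrixP => i j; rewrite mul_mx_diag mul_diag_mx !mxE.
    case: eqVneq => [->|]; rewrite ?mulr0n ?mulr1n; last by rewrite !(mulr0,mul0r).
    by have [->|dj0] := eqVneq (d 0 j) 0;
      [rewrite invr0 !mulr0|rewrite mulVf// mul1r].
  have -> : \sum_k M l k ^+ 2 = (M *m M^T) l l.
    by rewrite [RHS]mxE; apply: eq_bigr => k _; rewrite [X in _ * X]mxE expr2.
  have V1 : \sum_j V j l ^+ 2 = 1.
    transitivity ((V^T *m V) l l); last by rewrite VTV mxE eqxx.
    by rewrite mxE; apply: eq_bigr => k _; rewrite mxE.
  rewrite MM mul_mx_diag mxE -[leRHS]mulr1 -V1 mulr_sumr.
  apply: ler_sum => j _; rewrite !mxE [V j l * _]mulrC -mulrA -expr2.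
  apply: ler_wpM2r; first exact: sqr_ge0.
  have [->|dj0] := eqVneq (d 0 j) 0; first by rewrite invr0 invr_ge0 sqr_ge0.
  have sq0 : Num.sqrt (d 0 j) != 0 by rewrite sqrtr_eq0 -ltNge lt_neqAle eq_sym dj0 d0.
  have sin : Num.sqrt (d 0 j) \in singular_values B.
    by rewrite (perm_mem ss); apply: map_f; rewrite mem_enum.
  rewrite lef_pV2 ?posrE ?exprn_gt0 ?(sigma_min_gt0 sin)//; last first.
    by rewrite lt_neqAle eq_sym dj0 d0.
  rewrite -[leRHS]sqr_sqrtr// lerXn2r ?nnegrE ?sqrtr_ge0//; last exact: sigma_min_le.
  by rewrite ltW ?(sigma_min_gt0 sin).
Qed.

(** * Sub-Gaussian concentration *)

Section SimpleApproximation.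
Import HBNNSimple.

(** Factorization against indicators passes to simple functions by linearity and to nonnegative f by
    monotone convergence; finiteness of the integral of g lets the limit through the product. *)
Lemma ge0_integral_mul_indep (R : realType) (disp : measure_display)
  (T : measurableType disp) (P : probability T R) (X : T -> R) (g : T -> R)
  (f : R -> R) :
  measurable_fun setT X -> measurable_fun setT g -> measurable_fun [set: R] f ->
  (forall w, 0 <= g w) -> (forall x, 0 <= f x) ->
  (\int[P]_w (g w)%:E < +oo)%E ->
  (forall A, measurable A -> \int[P]_w (\1_A (X w) * g w)%:E =
     P (X @^-1` A) * \int[P]_w (g w)%:E)%E ->
  (\int[P]_w (f (X w) * g w)%:E =
     \int[P]_w (f (X w))%:E * \int[P]_w (g w)%:E)%E.
Proof.
move=> mX mg mf g0 f0 Goo indep.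
have mEf : measurable_fun [set: R] (EFin \o f).
  exact/measurable_EFinP.
pose h := nnsfun_approx measurableT mEf.
have h_simple n : (\int[P]_w (h n (X w) * g w)%:E =
    \int[P]_w (h n (X w))%:E * \int[P]_w (g w)%:E)%E.
  have mI r : measurable_fun setT (fun w => \1_(h n @^-1` [set r]) (X w) : R).
    by apply: measurableT_comp => //; exact: measurable_indic.
  have I0 r w : (0 <= (r * \1_(h n @^-1` [set r]) (X w))%:E)%E.
    by rewrite EFinM; exact: nnfun_muleindic_ge0.
  transitivity (\sum_(r \in range (h n))
      (\int[P]_w (r * \1_(h n @^-1` [set r]) (X w) * g w)%:E))%E.
    rewrite -ge0_integral_fsum//; last 2 first.
    - move=> r; apply/measurable_EFinP; apply: measurable_funM => //.
      by apply: measurable_funM => //; exact: mI.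
    - by move=> r w _; rewrite EFinM mule_ge0// lee_fin.
    apply: eq_integral => w _.
    rewrite fimfunE EFinM -fsumEFin// ge0_mule_fsuml//.
  transitivity ((\sum_(r \in range (h n))
      (\int[P]_w (r * \1_(h n @^-1` [set r]) (X w))%:E)) * \int[P]_w (g w)%:E)%E.
    rewrite ge0_mule_fsuml//; last by move=> r; apply: integral_ge0 => w _.
    apply: eq_fsbigr => r rh.
    have r0 : 0 <= r by move: rh; rewrite inE => -[x _ <-].
    under eq_integral do rewrite -mulrA EFinM.
    under [in RHS]eq_integral do rewrite EFinM.
    rewrite !ge0_integralZl_EFin//; last 3 first.
    - by apply/measurable_EFinP; exact: mI.
    - by move=> w _; rewrite lee_fin mulr_ge0.
    - by apply/measurable_EFinP; apply: measurable_funM => //; exact: mI.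
    rewrite indep// -muleA; congr (_ * (_ * _))%E.
    rewrite -(setIT (X @^-1` _)) -integral_indic//.
    by rewrite -[X in measurable X]setTI; exact: mX.
  congr (_ * _)%E; rewrite -ge0_integral_fsum//; last 1 first.
  - by move=> r; apply/measurable_EFinP; apply: measurable_funM => //; exact: mI.
  by apply: eq_integral => w _; rewrite fimfunE -fsumEFin.
have mh n : measurable_fun setT (fun w => h n (X w)).
  by apply: measurableT_comp.
have cvg1 : (\int[P]_w (h n (X w) * g w)%:E @[n --> \oo] -->
    \int[P]_w (f (X w) * g w)%:E)%E.
  rewrite (_ : (\int[P]_w (f (X w) * g w)%:E =
    \int[P]_w limn (fun n => (h n (X w) * g w)%:E))%E); last first.
    apply: eq_integral => w _; apply/esym/cvg_lim => //.
    under eq_fun do rewrite EFinM.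
    rewrite EFinM; apply: cvgeZr => //.
    by apply: cvg_nnsfun_approx => // x _; rewrite lee_fin.
  apply: cvg_monotone_convergence => //.
  - by move=> n; apply/measurable_EFinP; exact: measurable_funM.
  - by move=> n w _; rewrite lee_fin mulr_ge0.
  - move=> w _ m n mn; rewrite lee_fin ler_wpM2r//.
    by have /lefP/(_ (X w)) := nd_nnsfun_approx measurableT mEf mn.
have cvg2 : (\int[P]_w (h n (X w))%:E @[n --> \oo] -->
    \int[P]_w (f (X w))%:E)%E.
  rewrite (_ : (\int[P]_w (f (X w))%:E =
    \int[P]_w limn (fun n => (h n (X w))%:E))%E); last first.
    apply: eq_integral => w _; apply/esym/cvg_lim => //.
    by apply: cvg_nnsfun_approx => // x _; rewrite lee_fin.
  apply: cvg_monotone_convergence => //.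
  - by move=> n; apply/measurable_EFinP.
  - by move=> n w _; rewrite lee_fin.
  - move=> w _ m n mn; rewrite lee_fin.
    by have /lefP/(_ (X w)) := nd_nnsfun_approx measurableT mEf mn.
have cvg3 : (\int[P]_w (h n (X w) * g w)%:E @[n --> \oo] -->
    \int[P]_w (f (X w))%:E * \int[P]_w (g w)%:E)%E.
  under eq_fun do rewrite h_simple.
  apply: cvgeZr cvg2; rewrite ge0_fin_numE//.
  by apply: integral_ge0 => w _; rewrite lee_fin.
exact: cvg_unique cvg1 cvg3.
Qed.

End SimpleApproximation.

(** Indicators are traded for the functions [f i] one index at a time: [h s A] carries [f i] on s
    and indicators elsewhere. The induction on s keeps the events A arbitrary. *)
Lemma independent_integral_prod (R : realType) (disp : measure_display)
  (T : measurableType disp) (P : probability T R) (I : finType)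
  (X : I -> {RV P >-> R}) (f : I -> R -> R) :
  mutually_independent X -> (forall i, measurable_fun [set: R] (f i)) ->
  (forall i x, 0 <= f i x) -> (forall i, \int[P]_w (f i (X i w))%:E < +oo)%E ->
  (\int[P]_w (\prod_i f i (X i w))%:E = \prod_i \int[P]_w (f i (X i w))%:E)%E.
Proof.
move=> indep mf f0 foo.
pose h (s : seq I) (A : I -> set R) i : R -> R :=
  if i \in s then f i else \1_(A i).
suff H s A : uniq s -> (forall i, measurable (A i)) ->
    (\int[P]_w (\prod_i h s A i (X i w))%:E
      = \prod_i \int[P]_w (h s A i (X i w))%:E)%E.
  have hE i : h (enum I) (fun=> setT) i = f i by rewrite /h mem_enum.
  have := H (enum I) (fun=> setT) (enum_uniq _) (fun=> measurableT).
  under eq_integral do under eq_bigr do rewrite hE.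
  by under [in RHS]eq_bigr do rewrite hE.
have mh s' A' i : (forall i, measurable (A' i)) -> measurable_fun [set: R] (h s' A' i).
  by move=> mA; rewrite /h; case: ifP => // _; exact: measurable_indic.
have h0 s' A' i x : 0 <= h s' A' i x by rewrite /h; case: ifP.
have mhX s' A' i : (forall i, measurable (A' i)) ->
    measurable_fun setT (fun w => h s' A' i (X i w)).
  by move=> mA; apply: measurableT_comp => //; exact: mh.
have indX i (B : set R) : measurable B ->
    (\int[P]_w (\1_B (X i w))%:E)%E = P (X i @^-1` B).
  move=> mB; rewrite -(setIT (X i @^-1` _)) -integral_indic//.
  by rewrite -[Y in measurable Y]setTI; exact: measurable_funP.
elim: s A => [|i s IH] A us mA.
  have -> : (\prod_i \int[P]_w (h [::] A i (X i w))%:E = \prod_i P (X i @^-1` A i))%E.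
    by apply: eq_bigr => i _; rewrite /h in_nil indX.
  have := indep [set: I]%SET A mA.
  have -> : (\prod_(i in [set: I]%SET) P (X i @^-1` A i) = \prod_i P (X i @^-1` A i))%E.
    by apply: eq_bigl => i; rewrite finset.in_setT.
  move=> <-.
  have mAX : measurable (\bigcap_(i in [set` [set: I]%SET]) (X i @^-1` A i)).
    apply: fin_bigcap_measurable => // i _.
    by rewrite -[Y in measurable Y]setTI; exact: measurable_funP.
  rewrite -(setIT (\bigcap_(i in _) _)) -integral_indic//.
  apply: eq_integral => w _; congr _%:E; rewrite indicE.
  case: (boolP (w \in _)) => wA.
    rewrite big1// => i _; rewrite /h in_nil indicE mem_set//.
    by move: wA; rewrite inE => /(_ i); apply; rewrite /= finset.in_setT.
  have [i Hi] : exists i, X i w \notin A i.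
    apply/existsP; move: wA; apply: contraNT; rewrite negb_exists => /forallP wA.
    by rewrite inE => i _; have := wA i; rewrite negbK inE.
  by rewrite (bigD1 i)//= /h in_nil indicE (negPf Hi) mul0r.
move: us; rewrite /= => /andP[si us].
(* Letting the event at i range over all B in the induction hypothesis yields the factorization
   against indicators that [ge0_integral_mul_indep] asks for. *)
pose A' B j := if j == i then B else A j.
have mA' B : measurable B -> forall j, measurable (A' B j).
  by move=> mB j; rewrite /A'; case: ifP.
pose g w := \prod_(j | j != i) h (i :: s) A j (X j w).
have g0 w : 0 <= g w by apply: prodr_ge0.
have mg : measurable_fun setT g.
  have -> : g = fun w =>
      \prod_j (if j != i then h (i :: s) A j (X j w) else 1).
    by apply/funext => w; rewrite /g big_mkcond.
  by apply: measurable_prod => j _; case: (j != i) => //; exact: mhX.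
have hg B j : j != i -> h (i :: s) A j = h s (A' B) j.
  by move=> ji; rewrite /h in_cons (negPf ji) /= /A' (negPf ji).
have hB B w : \prod_j h s (A' B) j (X j w) = \1_B (X i w) * g w.
  rewrite (bigD1 i)//= {1}/h (negPf si) /A' eqxx; congr (_ * _).
  by apply: eq_bigr => j ji; rewrite (hg B).
have gB B : measurable B -> (\int[P]_w (\1_B (X i w) * g w)%:E =
    P (X i @^-1` B) * \prod_(j | j != i) \int[P]_w (h (i :: s) A j (X j w))%:E)%E.
  move=> mB; under eq_integral do rewrite -hB.
  rewrite IH//; last exact: mA'.
  rewrite (bigD1 i)//= {1}/h (negPf si) {1}/A' eqxx indX//; congr (_ * _)%E.
  by apply: eq_bigr => j ji; apply: eq_integral => w _; rewrite (hg B).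
have gE : (\int[P]_w (g w)%:E =
    \prod_(j | j != i) \int[P]_w (h (i :: s) A j (X j w))%:E)%E.
  have := gB _ measurableT; rewrite preimage_setT probability_setT mul1e => <-.
  by apply: eq_integral => w _; rewrite indicT mul1r.
have hi : h (i :: s) A i = f i by rewrite /h mem_head.
rewrite [RHS](bigD1 i)//= hi -gE.
transitivity (\int[P]_w (f i (X i w) * g w)%:E)%E.
  by apply: eq_integral => w _; rewrite (bigD1 i)//= hi.
have hoo j : (\int[P]_w (h (i :: s) A j (X j w))%:E < +oo)%E.
  rewrite /h; case: ifP => // _.
  rewrite indX//; apply: le_lt_trans (ltry 1).
  apply: probability_le1.
  by rewrite -[Y in measurable Y]setTI; exact: measurable_funP.
apply: ge0_integral_mul_indep => //; last by move=> B mB; rewrite gB// gE.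
rewrite -ge0_fin_numE; last by apply: integral_ge0 => w _; rewrite lee_fin.
rewrite gE; apply: (big_ind (fun x : \bar R => x \is a fin_num)) => //.
- by move=> x y; exact: fin_numM.
- move=> j _; rewrite ge0_fin_numE//.
  by apply: integral_ge0 => w _; rewrite lee_fin.
Qed.

Lemma sub_gaussian_linear (R : realType) (disp : measure_display)
  (T : measurableType disp) (P : probability T R) (I : finType)
  (X : I -> {RV P >-> R}) (sigma : R) (c : I -> R) :
  mutually_independent X -> (forall i, sub_gaussian (X i) sigma) ->
  (\int[P]_w (expR (\sum_i c i * X i w))%:E <=
   (expR (sigma ^+ 2 * (\sum_i c i ^+ 2) / 2))%:E)%E.
Proof.
move=> indep sg.
have sgi i : (\int[P]_w (expR (c i * X i w))%:E <=
    (expR (sigma ^+ 2 * c i ^+ 2 / 2))%:E)%E.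
  by have := sg i (c i); rewrite unlock.
under eq_integral do rewrite expR_sum.
rewrite (independent_integral_prod indep (f := fun i x => expR (c i * x))).
- rewrite mulr_sumr mulr_suml expR_sum -prodEFin.
  suff : (0 <= \prod_i \int[P]_w (expR (c i * X i w))%:E /\
      \prod_i \int[P]_w (expR (c i * X i w))%:E <=
      \prod_i (expR (sigma ^+ 2 * c i ^+ 2 / 2))%:E)%E by case.
  elim/big_ind2 : _ => [|x y z t [x0 xy] [z0 zt]|i _]; first by rewrite lee_fin.
    by split; [exact: mule_ge0|exact: lee_pmul].
  by split; [apply: integral_ge0 => w _; rewrite lee_fin expR_ge0|exact: sgi].
- by move=> i; apply: measurableT_comp => //; exact: measurable_funM.
- by move=> i x; exact: expR_ge0.
- by move=> i; exact: le_lt_trans (sgi i) (ltry _).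
Qed.

(** Completing the square turns the integrand into a constant times the normal density of mean
    [s ^+ 2 * y]. *)
Lemma integral_normal_pdf_exp_mul (R : realType) (s y : R) : s != 0 ->
  (\int[lebesgue_measure]_x (normal_pdf 0 s x * expR (x * y))%:E =
   (expR (s ^+ 2 * y ^+ 2 / 2))%:E)%E.
Proof.
move=> s0; set c := expR _.
transitivity (\int[lebesgue_measure]_x
    (c%:E * (normal_pdf (s ^+ 2 * y) s x)%:E))%E.
  apply: eq_integral => x _; rewrite -EFinM; congr _%:E.
  rewrite !normal_pdfE//= /normal_fun [RHS]mulrCA -[LHS]mulrA; congr (_ * _).
  by rewrite /c -!expRD; congr expR; field.
rewrite ge0_integralZl_EFin//.
- by rewrite integral_normal_pdf mule1.
- by move=> x _; rewrite lee_fin normal_pdf_ge0.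
- by apply/measurable_EFinP; exact: measurable_normal_pdf.
- exact: expR_ge0.
Qed.

(** The exponential halves the quadratic exponent of the density, leaving the normal density of
    variance 1 / s^2; the quotient of the two peaks is sqrt 2. *)
Lemma integral_normal_pdf_exp_sqr (R : realType) (s : R) : 0 < s ->
  (\int[lebesgue_measure]_x
     (normal_pdf 0 (Num.sqrt 2 * s)^-1 x * expR (s ^+ 2 * x ^+ 2 / 2))%:E =
   (Num.sqrt 2)%:E)%E.
Proof.
move=> s0.
have q0 : 0 < Num.sqrt 2 :> R by rewrite sqrtr_gt0.
have s1 : (Num.sqrt 2 * s)^-1 != 0 by rewrite invr_eq0 mulf_neq0 ?gt_eqF.
have s2 : s^-1 != 0 by rewrite invr_eq0 gt_eqF.
transitivity (\int[lebesgue_measure]_x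
    ((Num.sqrt 2)%:E * (normal_pdf 0 s^-1 x)%:E))%E.
  apply: eq_integral => x _; rewrite -EFinM; congr _%:E.
  rewrite !normal_pdfE//= /normal_fun -[LHS]mulrA -expRD [RHS]mulrA; congr (_ * expR _).
    rewrite /normal_peak invfM exprMn !exprVn sqr_sqrtr//.
    rewrite -[_ * pi]mulrA -mulrnAr sqrtrM; last by rewrite invr_ge0.
    by rewrite invfM sqrtrV// invrK.
  rewrite !subr0 invfM exprMn !exprVn sqr_sqrtr//.
  by field; rewrite gt_eqF.
rewrite ge0_integralZl_EFin//.
- by rewrite integral_normal_pdf mule1.
- by move=> x _; rewrite lee_fin normal_pdf_ge0.
- by apply/measurable_EFinP; exact: measurable_normal_pdf.
Qed.

(* Writing expR (y ^+ 2 / (4 * sigma ^+ 2)) as a Gaussian mixture of the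
   exponentials expR (x * y) trades the square of one coordinate for a linear
   form; the squares are removed one at a time by Tonelli's theorem. *)
Lemma integral_exp_sum_sqr_le (R : realType) (disp : measure_display)
  (T : measurableType disp) (P : probability T R) (I : finType)
  (Y : I -> T -> R) (sigma : R) :
  0 < sigma -> (forall i, measurable_fun setT (Y i)) ->
  (forall c : I -> R, \int[P]_w (expR (\sum_i c i * Y i w))%:E <=
     (expR (sigma ^+ 2 * (\sum_i c i ^+ 2) / 2))%:E)%E ->
  (\int[P]_w (expR (\sum_i Y i w ^+ 2 / (4 * sigma ^+ 2)))%:E <=
     (Num.sqrt 2 ^+ #|I|)%:E)%E.
Proof.
move=> s0 mY sg.
(* Intermediate stage: squares at the indices of s, a linear form elsewhere. Its coefficients c stay
   arbitrary so that the mixing variable can become one of them. *)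
pose u (s : seq I) (c : I -> R) i w : R :=
  if i \in s then Y i w ^+ 2 / (4 * sigma ^+ 2) else c i * Y i w.
suff H s c : uniq s -> (\int[P]_w (expR (\sum_i u s c i w))%:E <=
    (Num.sqrt 2 ^+ size s *
     expR (sigma ^+ 2 * (\sum_(i | i \notin s) c i ^+ 2) / 2))%:E)%E.
  have := H (enum I) (fun=> 0) (enum_uniq _).
  rewrite big1 => [|i]; last by rewrite mem_enum.
  rewrite mulr0 mul0r expR0 mulr1 -cardE; apply: le_trans; rewrite le_eqVlt.
  apply/orP; left; apply/eqP/eq_integral => w _; congr (expR _)%:E.
  by apply: eq_bigr => i _; rewrite /u mem_enum.
have mu s' c' i : measurable_fun setT (u s' c' i).
  rewrite /u; case: (i \in s'); last exact: measurable_funM.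
  by apply: measurable_funM => //; exact: measurable_funX.
elim: s c => [|i s IH] c us.
  by rewrite expr0 mul1r; apply: le_trans (sg c) _.
move: us => /andP[si us].
pose G w := expR (\sum_(j | j != i) u (i :: s) c j w).
have mG : measurable_fun setT G.
  apply: measurableT_comp => //.
  have -> : (fun w => \sum_(j | j != i) u (i :: s) c j w) =
      fun w => \sum_j (if j != i then u (i :: s) c j w else 0).
    by apply/funext => w; rewrite big_mkcond.
  by apply: measurable_sum => j; case: (j != i).
(* With t^2 = 1 / (2 sigma^2) the Gaussian average of exp(x y) is exp(y^2 / (4 sigma^2)). The linear
   term x y costs at most exp(sigma^2 x^2 / 2), whose average under the same Gaussian is sqrt 2. *)
pose t := (Num.sqrt 2 * sigma)^-1.
have q0 : 0 < Num.sqrt 2 :> R by rewrite sqrtr_gt0.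
have t0 : t != 0 by rewrite invr_eq0 mulf_neq0 ?gt_eqF.
have tt : t ^+ 2 = (2 * sigma ^+ 2)^-1 by rewrite exprVn exprMn sqr_sqrtr.
pose F (z : T * measurableTypeR R) : \bar R :=
  (normal_pdf 0 t z.2 * (expR (z.2 * Y i z.1) * G z.1))%:E.
have mF : measurable_fun setT F.
  apply/measurable_EFinP; apply: measurable_funM.
    by apply: measurableT_comp measurable_snd; exact: measurable_normal_pdf.
  apply: measurable_funM; last exact: measurableT_comp measurable_fst.
  apply: measurableT_comp => //; apply: measurable_funM; first exact: measurable_snd.
  exact: measurableT_comp measurable_fst.
have F0 z : (0 <= F z)%E.
  by rewrite lee_fin mulr_ge0 ?normal_pdf_ge0// mulr_ge0 ?expR_ge0.
have -> : (\int[P]_w (expR (\sum_i0 u (i :: s) c i0 w))%:E =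
    \int[P]_w \int[lebesgue_measure]_x F (w, x))%E.
  apply: eq_integral => w _.
  transitivity (\int[lebesgue_measure]_x
      ((G w)%:E * (normal_pdf 0 t x * expR (x * Y i w))%:E))%E; last first.
    by apply: eq_integral => x _; rewrite /F /= -EFinM; congr _%:E; ring.
  rewrite ge0_integralZl_EFin ?expR_ge0//; last 2 first.
  - by move=> x _; rewrite lee_fin mulr_ge0 ?normal_pdf_ge0 ?expR_ge0.
  - apply/measurable_EFinP; apply: measurable_funM.
      exact: measurable_normal_pdf.
    by apply: measurableT_comp => //; exact: measurable_funM.
  rewrite integral_normal_pdf_exp_mul// -EFinM -expRD (bigD1 i)//= addrC.
  congr (expR (_ + _))%:E; rewrite /u mem_head tt.
  by field; rewrite gt_eqF.
rewrite (fubini_tonelli F mF F0).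
pose K := Num.sqrt 2 ^+ size s *
  expR (sigma ^+ 2 * (\sum_(j | j \notin i :: s) c j ^+ 2) / 2).
have K0 : 0 <= K by rewrite mulr_ge0 ?expR_ge0// exprn_ge0.
apply: (@le_trans _ _ (\int[lebesgue_measure]_x
    (K%:E * (normal_pdf 0 t x * expR (sigma ^+ 2 * x ^+ 2 / 2))%:E))%E).
  apply: ge0_le_integral => //.
  - by move=> x _; apply: integral_ge0.
  - exact: (measurable_fun_fubini_tonelli_G F mF F0).
  - apply/measurable_EFinP; apply: measurable_funM => //.
    apply: measurable_funM; first exact: measurable_normal_pdf.
    apply: measurableT_comp => //; apply: measurable_funM => //.
    by apply: measurable_funM => //; exact: measurable_funX.
  move=> x _; rewrite /F /=.
  under eq_integral do rewrite EFinM.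
  rewrite ge0_integralZl_EFin ?normal_pdf_ge0//; last 2 first.
  - by move=> w _; rewrite lee_fin mulr_ge0 ?expR_ge0.
  - apply/measurable_EFinP; apply: measurable_funM => //.
    by apply: measurableT_comp => //; exact: measurable_funM.
  rewrite -EFinM mulrCA EFinM lee_wpmul2l ?lee_fin ?normal_pdf_ge0//.
  (* For fixed x the removed square is a linear term, so the induction hypothesis applies with
     coefficient x at i. *)
  have := IH (fun j => if j == i then x else c j) us.
  congr (_ <= _)%E.
    apply: eq_integral => w _; rewrite -expRD (bigD1 i)//=; congr (expR (_ + _))%:E.
      by rewrite /u (negPf si) eqxx.
    by apply: eq_bigr => j ji; rewrite /u in_cons (negPf ji).
  rewrite /K -(mulrA (Num.sqrt 2 ^+ _)) -expRD; congr (_ * expR _)%:E.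
  rewrite (bigD1 i)//= eqxx -mulrDl -mulrDr addrC; congr (_ * (_ + _) / _).
  apply: eq_big => [j|j /andP[_ ji]]; first by rewrite in_cons negb_or andbC.
  by rewrite (negPf ji).
rewrite ge0_integralZl_EFin//; last 2 first.
- by move=> x _; rewrite lee_fin mulr_ge0 ?normal_pdf_ge0 ?expR_ge0.
- apply/measurable_EFinP; apply: measurable_funM.
    exact: measurable_normal_pdf.
  apply: measurableT_comp => //; apply: measurable_funM => //.
  by apply: measurable_funM => //; exact: measurable_funX.
rewrite integral_normal_pdf_exp_sqr// -EFinM lee_fin /K /=.
by rewrite [_ ^+ (size s).+1]exprS mulrC mulrA.
Qed.

(** * Tail bounds from exponential moments *)

Lemma measurable_gt (R : realType) (disp : measure_display)
  (T : measurableType disp) (f : T -> R) (a : R) :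
  measurable_fun setT f -> measurable [set w | a < f w].
Proof.
move=> mf; rewrite -[X in measurable X]setTI.
exact: (measurable_fun_ltr (measurable_cst a) mf measurableT).
Qed.

Lemma measurable_le (R : realType) (disp : measure_display)
  (T : measurableType disp) (f : T -> R) (a : R) :
  measurable_fun setT f -> measurable [set w | f w <= a].
Proof.
move=> mf; rewrite -[X in measurable X]setTI.
exact: (measurable_fun_ler mf (measurable_cst a) measurableT).
Qed.

Lemma probability_le_integral (R : realType) (disp : measure_display)
  (T : measurableType disp) (P : probability T R) (A : set T) (f : T -> R) :
  measurable A -> measurable_fun setT f -> (forall w, 0 <= f w) ->
  (forall w, A w -> 1 <= f w) -> (P A <= \int[P]_w (f w)%:E)%E.
Proof.
move=> mA mf f0 f1; rewrite -(setIT A) -integral_indic//.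
apply: ge0_le_integral => //.
- by apply/measurable_EFinP; exact: measurable_indic.
- exact/measurable_EFinP.
- move=> w _; rewrite lee_fin indicE.
  by have [wA|//] := boolP (w \in A); apply: f1; rewrite -in_setE.
Qed.

(* Chernoff with exponent 4 L / t, which also covers sigma = 0. *)
Lemma sub_gaussian_tail (R : realType) (disp : measure_display)
  (T : measurableType disp) (P : probability T R) (Y : T -> R) (v L t : R) :
  measurable_fun setT Y ->
  (forall s : R, (\int[P]_w (expR (s * Y w))%:E <= (expR (v * s ^+ 2 / 2))%:E)%E) ->
  0 <= L -> 0 < t -> 4 * v * L <= t ^+ 2 ->
  (P [set w | t < `|Y w|]%R <= (2 * expR (- (2 * L)))%:E)%E.
Proof.
move=> mY sg L0 t0 vLt.
have mYs s : measurable_fun setT (fun w => expR (s * Y w)).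
  by apply: measurableT_comp => //; exact: measurable_funM.
pose l := 4 * L / t.
pose f w := expR (- (4 * L)) * (expR (l * Y w) + expR (- l * Y w)).
have mf : measurable_fun setT f.
  by apply: measurable_funM => //; exact: measurable_funD.
apply: (@le_trans _ _ (\int[P]_w (f w)%:E)%E).
  apply: probability_le_integral => //.
  - by apply: measurable_gt; exact: measurableT_comp.
  - by move=> w; rewrite mulr_ge0 ?addr_ge0 ?expR_ge0.
  move=> w /= tY; rewrite /f mulrDr -!expRD.
  have l0 : 0 <= l by rewrite /l divr_ge0 ?mulr_ge0// ltW.
  have lt : 4 * L = l * t by rewrite /l divfK ?gt_eqF.
  move: tY; rewrite ltr_normr => /orP[tY|tY].
    rewrite -[leLHS]addr0 lerD ?expR_ge0// -[leLHS]expR0 ler_expR lt addrC.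
    by rewrite subr_ge0 ler_wpM2l// ltW.
  rewrite -[leLHS]add0r lerD ?expR_ge0// -[leLHS]expR0 ler_expR lt addrC.
  by rewrite subr_ge0 mulNr -mulrN ler_wpM2l// ltW.
under eq_integral do rewrite EFinM EFinD.
rewrite ge0_integralZl_EFin ?expR_ge0//; last 2 first.
- by move=> w _; rewrite lee_fin addr_ge0 ?expR_ge0.
- by apply/measurable_EFinP; exact: measurable_funD.
rewrite ge0_integralD//; last 2 first.
- exact/measurable_EFinP.
- exact/measurable_EFinP.
apply: (@le_trans _ _ ((expR (- (4 * L)))%:E *
    ((expR (v * l ^+ 2 / 2))%:E + (expR (v * l ^+ 2 / 2))%:E))%E).
  rewrite lee_wpmul2l ?lee_fin ?expR_ge0// leeD//.
  by rewrite -(sqrrN l).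
rewrite -EFinD -EFinM lee_fin -mulr2n -[X in _ * X <= _]mulr_natl mulrCA.
rewrite ler_pM2l// -expRD ler_expR.
(* Since l t = 4 L, the exponent is v l^2 / 2 - 4 L; the hypothesis on t bounds its first term by 2
   L. *)
have : v * l ^+ 2 <= 4 * L.
  rewrite /l expr_div_n mulrA ler_pdivrMr ?exprn_gt0//.
  rewrite (_ : v * (4 * L) ^+ 2 = 4 * L * (4 * v * L)); last by ring.
  by rewrite ler_wpM2l// mulr_ge0.
lra.
Qed.

(** Continuity from below. It lets a tail bound be proved at a slightly larger threshold, where
    sigma can be replaced by something strictly larger, hence positive. *)
Lemma probability_gt_le (R : realType) (disp : measure_display)
  (T : measurableType disp) (P : probability T R) (S : T -> R) (a p : R) :
  measurable_fun setT S ->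
  (forall a', a < a' -> (P [set w | (a' < S w)%R] <= p%:E)%E) ->
  (P [set w | (a < S w)%R] <= p%:E)%E.
Proof.
move=> mS Hp.
pose F n := [set w | a + n.+1%:R^-1 < S w].
have mF n : measurable (F n) by exact: measurable_gt.
have -> : [set w | a < S w] = \bigcup_n F n.
  apply/seteqP; split => [w /= aS|w [n _] /=]; last first.
    by apply: lt_trans; rewrite ltrDl invr_gt0.
  have e0 : 0 < S w - a by rewrite subr_gt0.
  have [n _ /(_ n (leqnn n)) /= an] := near_infty_natSinv_lt (PosNum e0).
  by exists n => //; rewrite /F /= addrC -ltrBrDr.
have Fcvg : P \o F @ \oo --> P (\bigcup_n F n).
  apply: nondecreasing_cvg_mu => //; first exact: bigcupT_measurable.
  move=> m n mn; apply/subsetPset => w; apply: le_lt_trans.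
  by rewrite lerD2l lef_pV2 ?posrE// ler_nat ltnS.
apply: cvge_le Fcvg; apply: nearW => n /=.
by apply: Hp; rewrite ltrDl invr_gt0.
Qed.

(** Markov's inequality for the exponential of the sum divided by 4 sigma^2: the threshold
    contributes exp(-(#|I| + t) / 2), the moment at most 2^(#|I| / 2) <= exp(#|I| / 2), and exp(-t /
    2) is left. *)
Lemma chi_square_tail (R : realType) (disp : measure_display)
  (T : measurableType disp) (P : probability T R) (I : finType)
  (Y : I -> T -> R) (sigma t : R) :
  0 <= sigma -> 0 <= t -> (forall i, measurable_fun setT (Y i)) ->
  (forall c : I -> R, \int[P]_w (expR (\sum_i c i * Y i w))%:E <=
     (expR (sigma ^+ 2 * (\sum_i c i ^+ 2) / 2))%:E)%E ->
  (P [set w | 2 * sigma ^+ 2 * (#|I|%:R + t) < \sum_i Y i w ^+ 2]%R <=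
     (expR (- (t / 2)))%:E)%E.
Proof.
move=> sg0 t0 mY sg.
have [I0|I_gt0] := posnP #|I|.
  rewrite (_ : [set _ | _] = set0) ?measure0 ?lee_fin ?expR_ge0//.
  apply/seteqP; split => // w /=; apply/negP; rewrite -leNgt big1.
    by rewrite mulr_ge0 ?mulr_ge0 ?sqr_ge0 ?addr_ge0.
  by move=> i; have := fintype0 i I0.
have mS : measurable_fun setT (fun w => \sum_i Y i w ^+ 2).
  by apply: measurable_sum => i; exact: measurable_funX.
have r0 : 0 < #|I|%:R + t by rewrite ltr_pwDl// ltr0n.
apply: probability_gt_le => // a' aa'.
(* Chosen so that a' is exactly the threshold for variance s2; as a' > a, s2 exceeds sigma^2 and is
   positive even for sigma = 0. *)
pose s2 := a' / (2 * (#|I|%:R + t)).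
have s2s : sigma ^+ 2 < s2.
  by rewrite /s2 ltr_pdivlMr ?mulr_gt0// mulrA [_ * 2]mulrC.
have s20 : 0 < s2 by rewrite (le_lt_trans _ s2s) ?sqr_ge0.
pose s := Num.sqrt s2.
have s_gt0 : 0 < s by rewrite sqrtr_gt0.
have ss : s ^+ 2 = s2 by rewrite sqr_sqrtr// ltW.
have := @integral_exp_sum_sqr_le _ _ _ P _ Y s s_gt0 mY.
move=> /(_ _)/wrap[c|H].
  apply: le_trans (sg c) _; rewrite lee_fin ler_expR ler_pM2r// ler_wpM2r//.
    by apply: sumr_ge0 => i _; rewrite sqr_ge0.
  by rewrite ss ltW.
pose f w := expR (- ((#|I|%:R + t) / 2)) * expR (\sum_i Y i w ^+ 2 / (4 * s ^+ 2)).
have mE : measurable_fun setT (fun w => expR (\sum_i Y i w ^+ 2 / (4 * s ^+ 2))).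
  apply: measurableT_comp => //; apply: measurable_sum => i.
  by apply: measurable_funM => //; exact: measurable_funX.
apply: (@le_trans _ _ (\int[P]_w (f w)%:E)%E).
  apply: probability_le_integral => //.
  - exact: measurable_gt.
  - exact: measurable_funM.
  - by move=> w; rewrite mulr_ge0 ?expR_ge0.
  move=> w /= aS; rewrite /f -expRD -[leLHS]expR0 ler_expR addrC subr_ge0.
  rewrite -mulr_suml ler_pdivlMr ?mulr_gt0 ?exprn_gt0// ss.
  rewrite (le_trans _ (ltW aS))// /s2 le_eqVlt; apply/orP; left; apply/eqP.
  by field; rewrite gt_eqF.
under eq_integral do rewrite EFinM.
rewrite ge0_integralZl_EFin ?expR_ge0//; last exact/measurable_EFinP.
apply: (@le_trans _ _ ((expR (- ((#|I|%:R + t) / 2)))%:E * (Num.sqrt 2 ^+ #|I|)%:E)%E).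
  by rewrite lee_wpmul2l ?lee_fin ?expR_ge0.
have q : Num.sqrt 2 <= expR (1 / 2) :> R.
  rewrite -(@ler_sqr _ (Num.sqrt 2)) ?nnegrE ?sqrtr_ge0 ?expR_ge0// sqr_sqrtr//.
  rewrite (_ : expR (1 / 2) ^+ 2 = expR 1); last first.
    by rewrite -expRM_natr; congr expR; field.
  have := expR_ge1Dx (1 : R); lra.
rewrite -EFinM lee_fin.
apply: (@le_trans _ _ (expR (- ((#|I|%:R + t) / 2)) * expR (1 / 2) ^+ #|I|)).
  by rewrite ler_wpM2l ?expR_ge0// lerXn2r ?nnegrE ?sqrtr_ge0 ?expR_ge0.
rewrite -expRM_natr -expRD ler_expR; lra.
Qed.

Lemma union_bound (R : realType) (disp : measure_display)
  (T : measurableType disp) (P : probability T R) (I : finType)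
  (F : I -> set T) (p : R) :
  (forall i, measurable (F i)) -> (forall i, P (F i) <= p%:E)%E ->
  measurable [set w | exists i, F i w] /\
  (P [set w | exists i, F i w] <= (#|I|%:R * p)%:E)%E.
Proof.
move=> mF Fp.
have -> : [set w | exists i, F i w] = \big[setU/set0]_(i <- enum I) F i.
  rewrite -bigcup_seq; apply/seteqP; split => [w [i Fi]|w [i _ Fi]].
    by exists i => //=; rewrite mem_enum.
  by exists i.
rewrite cardE; elim: (enum I) => [|i s [mU PU]].
  by rewrite big_nil measure0 mul0r.
rewrite big_cons; split; first exact: measurableU.
apply: le_trans; first exact: measureU2.
by rewrite /= mulrSr mulrDl mul1r addrC EFinD; exact: leeD.
Qed.

(** * Euclidean norm and proximal points *)

Definition dot (R : pzRingType) m (u v : 'cV[R]_m) : R := \sum_i u i 0 * v i 0.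

Lemma dotC (R : comPzRingType) m (u v : 'cV[R]_m) : dot u v = dot v u.
Proof. by apply: eq_bigr => i _; rewrite mulrC. Qed.

Lemma dotDl (R : pzRingType) m (u v z : 'cV[R]_m) :
  dot (u + v) z = dot u z + dot v z.
Proof. by rewrite -big_split; apply: eq_bigr => i _; rewrite mxE mulrDl. Qed.

Lemma dotZl (R : pzRingType) m (c : R) (u v : 'cV[R]_m) :
  dot (c *: u) v = c * dot u v.
Proof. by rewrite mulr_sumr; apply: eq_bigr => i _; rewrite mxE mulrA. Qed.

Lemma dotNl (R : pzRingType) m (u v : 'cV[R]_m) : dot (- u) v = - dot u v.
Proof. by rewrite -scaleN1r dotZl mulN1r. Qed.

Lemma dotDr (R : comPzRingType) m (u v z : 'cV[R]_m) :
  dot z (u + v) = dot z u + dot z v.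
Proof. by rewrite dotC dotDl !(dotC z). Qed.

Lemma dotZr (R : comPzRingType) m (c : R) (u v : 'cV[R]_m) :
  dot v (c *: u) = c * dot v u.
Proof. by rewrite dotC dotZl dotC. Qed.

Lemma dotNr (R : comPzRingType) m (u v : 'cV[R]_m) : dot v (- u) = - dot v u.
Proof. by rewrite dotC dotNl dotC. Qed.

Section EuclideanNorm.
Context (R : realType) (m : nat).
Implicit Types u v : 'cV[R]_m.

Lemma enorm_ge0 u : 0 <= enorm u.
Proof. exact: sqrtr_ge0. Qed.

Lemma enorm_sqr u : enorm u ^+ 2 = dot u u.
Proof.
rewrite sqr_sqrtr; last by apply: sumr_ge0 => i _; exact: sqr_ge0.
by apply: eq_bigr => i _; rewrite expr2.
Qed.

Lemma dot_le_enorm u v : dot u v <= enorm u * enorm v.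
Proof. exact: sum_mul_le_sqrt. Qed.

Lemma enormD u v : enorm (u + v) <= enorm u + enorm v.
Proof.
rewrite -ler_sqr ?nnegrE ?addr_ge0 ?enorm_ge0// sqrrD !enorm_sqr.
rewrite dotDl !dotDr (dotC v u).
have := dot_le_enorm u v; lra.
Qed.

Lemma enormZ c u : enorm (c *: u) = `|c| * enorm u.
Proof.
rewrite /enorm -sqrtr_sqr -sqrtrM ?sqr_ge0// mulr_sumr; congr Num.sqrt.
by apply: eq_bigr => i _; rewrite mxE exprMn.
Qed.

Lemma enorm_convex (s t : R) u v : 0 <= s -> 0 <= t ->
  enorm (s *: u + t *: v) <= s * enorm u + t * enorm v.
Proof.
by move=> s0 t0; apply: le_trans (enormD _ _) _; rewrite !enormZ !ger0_norm.
Qed.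

Lemma enormB u v : enorm (u - v) = enorm (v - u).
Proof. by rewrite -opprB -scaleN1r enormZ normrN1 mul1r. Qed.

Lemma enorm_le_const u (b : R) : 0 <= b -> (forall i, `|u i 0| <= b) ->
  enorm u <= Num.sqrt m%:R * b.
Proof.
move=> b0 ub; rewrite -[X in _ * X](ger0_norm b0) -sqrtr_sqr -sqrtrM// ler_wsqrtr//.
rewrite -[X in X%:R]card_ord -sum1_card natr_sum mulr_suml.
apply: ler_sum => i _; rewrite mul1r -real_normK ?num_real//.
by rewrite lerXn2r ?nnegrE.
Qed.

Lemma enorm_lip u v z : `|enorm (u - z) - enorm (v - z)| <= enorm (u - v).
Proof.
have tri p q : enorm (p - z) - enorm (q - z) <= enorm (p - q).
  rewrite lerBlDr; apply: le_trans (enormD _ _).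
  by rewrite addrA subrK.
rewrite ler_norml; apply/andP; split; last exact: tri.
by rewrite lerNl opprB [enorm (u - v)]enormB; exact: tri.
Qed.

End EuclideanNorm.

Definition convex_fun (R : realType) m (g : 'cV[R]_m -> R) := forall s t x y,
  0 <= s -> 0 <= t -> s + t = 1 -> g (s *: x + t *: y) <= s * g x + t * g y.

Section Prox.
Context (R : realType) (m : nat) (g : 'cV[R]_m -> R) (g_convex : convex_fun g).

Let f a x := 2^-1 * enorm (x - a) ^+ 2 + g x.

Lemma prox_variational a x y : minimizer (f a) x ->
  dot (x - a) (x - y) <= g y - g x.
Proof.
move=> xmin; set A := dot _ _; set B := dot (x - y) (x - y).
have B0 : 0 <= B by rewrite /B -enorm_sqr sqr_ge0.
have H s : 0 < s -> s <= 1 -> A <= g y - g x + s * B.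
  move=> s0 s1; have := xmin ((1 - s) *: x + s *: y).
  have s1' : 0 <= 1 - s by rewrite subr_ge0.
  have := g_convex x y s1' (ltW s0) (subrK _ _).
  rewrite /f !enorm_sqr.
  have -> : (1 - s) *: x + s *: y - a = (x - a) - s *: (x - y).
    by apply/matrixP => i j; rewrite !mxE; ring.
  rewrite /A; move: B0; rewrite /B; move: (x - a) (x - y) => p q B0.
  rewrite !(dotDl, dotDr, dotNl, dotNr, dotZl, dotZr) (dotC q p) => gc fc.
  have sB : 0 <= s * (s * dot q q) by rewrite !mulr_ge0// ltW.
  by rewrite -(ler_pM2l s0); lra.
have [//|AB] := leP A (g y - g x).
(* The claim is the limit s -> 0 of H; instead of a limit, one s is taken for which s B is less than
   half the supposed gap. *)
pose s := Num.min 1 ((A - (g y - g x)) / (2 * (B + 1))).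
have B1 : 0 < 2 * (B + 1) by rewrite mulr_gt0// ltr_pwDr.
have s0 : 0 < s by rewrite lt_min ltr01 divr_gt0// subr_gt0.
have := H s s0; rewrite ge_min lexx => /(_ isT).
have : s * (2 * (B + 1)) <= A - (g y - g x).
  by rewrite -ler_pdivlMr// ge_min lexx orbT.
have : 0 <= s * B by rewrite mulr_ge0// ltW.
lra.
Qed.

(** The two variational inequalities, each tested at the other minimizer, add up to |x - x'|^2 <= <a
    - a', x - x'>. *)
Lemma prox_nonexpansive a a' x x' : minimizer (f a) x -> minimizer (f a') x' ->
  enorm (x - x') <= enorm (a - a').
Proof.
move=> xmin xmin'.
have := prox_variational x' xmin; have := prox_variational x xmin'.
have := dot_le_enorm (a - a') (x - x').
have [->|e0] := eqVneq (enorm (x - x')) 0; first by rewrite enorm_ge0.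
have {}e0 : 0 < enorm (x - x') by rewrite lt_neqAle eq_sym e0 enorm_ge0.
move=> CS v' v; rewrite -(ler_pM2r e0) -expr2 enorm_sqr; apply: le_trans CS.
move: v v'; rewrite !(dotDl, dotDr, dotNl, dotNr) !(dotC x') (dotC a x) (dotC a' x).
lra.
Qed.

End Prox.

(** Each set where h exceeds t is the union of the boxes it contains, among the countably many with
    rational centre and radius 1 / (m + 1) in the coordinates X. *)
Lemma measurable_fun_lipschitz (R : realType) (disp : measure_display)
  (T : measurableType disp) (I : finType) (X : I -> T -> R) (h : T -> R) (K : R) :
  (forall i, measurable_fun setT (X i)) -> 0 <= K ->
  (forall w w' b, 0 <= b -> (forall i, `|X i w - X i w'| <= b) ->
    `|h w - h w'| <= K * b) ->
  measurable_fun setT h.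
Proof.
move=> mX K0 hX.
apply: (measurability _ (RGenOInfty.measurableE R)) => //.
move=> _ [_ [t ->] <-]; rewrite setTI preimage_itvoy.
pose box (q : {ffun I -> rat} * nat) :=
  [set w | forall i, `|X i w - ratr (q.1 i)| < q.2.+1%:R^-1].
have -> : [set w | t < h w] =
    \bigcup_q (if `[< box q `<=` [set w | t < h w] >] then box q else set0).
  apply/seteqP; split => [w /= th|w [q _]]; last first.
    by case: asboolP => // bq /bq.
  have K1 : 0 < K * 2 + 1 by rewrite ltr_pwDr// mulr_ge0.
  have e0 : 0 < (h w - t) / (K * 2 + 1) by rewrite divr_gt0 ?subr_gt0.
  (* Points of one box differ by less than 2 / (m + 1) in each coordinate, so h varies by less than
     h w - t; the 1 added to 2 K keeps the divisor positive when K = 0. *)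
  have [m _ /(_ m (leqnn m)) /= me] := near_infty_natSinv_lt (PosNum e0).
  have m0 : 0 < m.+1%:R^-1 :> R by rewrite invr_gt0.
  have /choice[q qP] : forall i, exists q : rat, `|X i w - ratr q| < m.+1%:R^-1.
    move=> i; have [|q] := @rat_in_itvoo R (X i w - m.+1%:R^-1) (X i w + m.+1%:R^-1).
      by rewrite ltrD2l gtrN.
    rewrite in_itv /= => /andP[q1 q2]; exists q.
    by rewrite ltr_distlC q1 q2.
  have wq : box ([ffun i => q i], m) w by move=> i; rewrite ffunE.
  exists ([ffun i => q i], m) => //; case: asboolP => // nb; exfalso; apply: nb.
  move=> w' w'q /=.
  have : `|h w - h w'| <= K * (2 * m.+1%:R^-1).
    apply: hX => [|i]; first by rewrite mulr_ge0// ltW.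
    apply: le_trans (ler_distD (ratr ([ffun i => q i] i)) _ _) _.
    rewrite mulr_natl mulr2n; apply: lerD; apply/ltW; first exact: wq.
    by rewrite distrC; exact: w'q.
  rewrite ler_norml => /andP[_ hh].
  have {}me : m.+1%:R^-1 * (K * 2 + 1) < h w - t by rewrite -ltr_pdivlMr.
  move: hh me m0; move: (m.+1%:R^-1 : R) (h w) (h w') => b p p'; clear; lra.
apply: countable_bigcupT_measurable => [|q]; first exact: countableP.
case: asboolP => // _.
have -> : box q = \bigcap_(i in [set: I]) [set w | `|X i w - ratr (q.1 i)| < q.2.+1%:R^-1].
  by apply/seteqP; split => w /= H i; [move=> _; exact: H|exact: H].
apply: fin_bigcap_measurable => // i _.
rewrite -[Y in measurable Y]setTI.
apply: (@measurable_fun_ltr _ _ _ _ (fun w => `|X i w - ratr (q.1 i)|) (cst q.2.+1%:R^-1)) => //.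
by apply: measurableT_comp => //; exact: measurable_funB.
Qed.

(** * Incidence matrix and connected components *)

Section Orthonormal.
Context (R : realDomainType) (I J : finType) (b : J -> I -> R)
  (b_orthonormal : forall r r', \sum_i b r i * b r' i = (r == r')%:R).

Lemma orthonormal_parseval (c : J -> R) :
  \sum_i (\sum_r c r * b r i) ^+ 2 = \sum_r c r ^+ 2.
Proof.
under eq_bigr => i _.
  rewrite expr2 mulr_suml; under eq_bigr do rewrite mulr_sumr.
  over.
rewrite exchange_big /=; apply: eq_bigr => r _.
rewrite exchange_big /=.
transitivity (\sum_r' c r * c r' * (r == r')%:R).
  apply: eq_bigr => r' _; rewrite -b_orthonormal mulr_sumr.
  by apply: eq_bigr => i _; rewrite mulrACA.
rewrite (bigD1 r)//= eqxx mulr1 -expr2 big1 ?addr0// => r'.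
by rewrite eq_sym => /negPf ->; rewrite mulr0.
Qed.

Lemma orthonormal_bessel (h : I -> R) :
  \sum_r (\sum_i b r i * h i) ^+ 2 <= \sum_i h i ^+ 2.
Proof.
pose y r := \sum_i b r i * h i; rewrite -subr_ge0.
have -> : \sum_i h i ^+ 2 - \sum_r y r ^+ 2 =
    \sum_i (h i - \sum_r y r * b r i) ^+ 2.
  under [RHS]eq_bigr do rewrite sqrrB.
  rewrite big_split sumrB /= orthonormal_parseval -addrA; congr (_ + _).
  have -> : \sum_i h i * (\sum_r y r * b r i) *+ 2 = (\sum_r y r ^+ 2) *+ 2.
    rewrite sumrMnl; congr (_ *+ 2).
    under eq_bigr do rewrite mulr_sumr.
    rewrite exchange_big /=; apply: eq_bigr => r _.
    rewrite expr2 {3}/y mulr_sumr; apply: eq_bigr => i _; ring.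
  by rewrite mulr2n opprD subrK.
by apply: sumr_ge0 => i _; exact: sqr_ge0.
Qed.

End Orthonormal.

(** The normalized indicator of the component represented by r. For a symmetric relation these form,
    over the roots, an orthonormal basis of the functions constant on components. *)
Definition comp_vec (R : rcfType) n (e : rel 'I_n) (r i : 'I_n) : R :=
  (fingraph.root e i == r)%:R / Num.sqrt #|[pred j | fingraph.root e j == r]|%:R.

Section Components.
Context (R : realType) (n : nat) (e : rel 'I_n) (sym_e : symmetric e).

Let csym : connect_sym e := sym_connect_sym sym_e.
Let b := @comp_vec R n e.

Lemma comp_vec_mul r r' i : r != r' -> b r i * b r' i = 0.
Proof.
move=> rr'; rewrite /b /comp_vec mulrACA.
by case: (eqVneq (fingraph.root e i) r) => [->|_]; rewrite ?(negPf rr') ?(mulr0, mul0r).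
Qed.

Lemma comp_vec_orthonormal r r' : fingraph.roots e r ->
  \sum_i b r i * b r' i = (r == r')%:R.
Proof.
move=> rr; have [<-|rr'] := eqVneq r r'; last first.
  by rewrite big1// => i _; exact: comp_vec_mul.
set N := #|[pred j | fingraph.root e j == r]|.
have N0 : (N%:R : R) != 0.
  rewrite pnatr_eq0 -lt0n; apply/card_gt0P; exists r.
  by rewrite inE /= (eqP rr).
rewrite (eq_bigr (fun i => (fingraph.root e i == r)%:R / N%:R)); last first.
  move=> i _; rewrite /b /comp_vec -/N mulrACA -natrM mulnb andbb.
  by rewrite -invfM -expr2 sqr_sqrtr.
rewrite -mulr_suml -natr_sum.
have -> : (\sum_i (fingraph.root e i == r) = N)%N.
  by rewrite /N -sum1_card [RHS]big_mkcond /=; apply: eq_bigr => i _; rewrite inE; case: (_ == _).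
by rewrite divff.
Qed.

Lemma comp_vec_connect r i j : connect e i j -> b r i = b r j.
Proof. by move=> /(fingraph.rootP csym) ij; rewrite /b /comp_vec ij. Qed.

(** Q = I - B M is symmetric and annihilates B, so its columns are constant along edges and Pi Q =
    Q. Also Pi B = 0, so Pi Q = Pi. Hence Q = Pi. *)
Lemma incidence_projection : irreflexive e ->
  exists2 M : 'M[R]_(#|edges e|, n),
    (forall l, \sum_i M l i ^+ 2 <= (sigma_min (incidence R e)) ^- 2) &
    forall (x h : 'I_n -> R), \sum_i x i * h i =
      \sum_(r : {r in fingraph.roots e})
        (\sum_i b (val r) i * x i) * (\sum_i b (val r) i * h i)
      + \sum_l (\sum_i M l i * x i) * (h (enum_val l).1 - h (enum_val l).2).
Proof.
move=> irr_e; set B := incidence R e.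
have [M [symBM BMB Mle]] := bounded_pseudo_inverse B.
exists M => //.
pose Pi : 'M[R]_n := \matrix_(i, j) \sum_(r | fingraph.roots e r) b r i * b r j.
have BtE (v : 'I_n -> R) l :
    \sum_i B i l * v i = v (enum_val l).1 - v (enum_val l).2.
  under eq_bigr do rewrite mxE mulrBl.
  rewrite sumrB; congr (_ - _).
    rewrite (bigD1 (enum_val l).1)//= eqxx mul1r big1 ?addr0// => i /negPf ->.
    by rewrite mul0r.
  rewrite (bigD1 (enum_val l).2)//= eqxx mul1r big1 ?addr0// => i /negPf ->.
  by rewrite mul0r.
have edge_e (l : 'I_#|edges e|) : e (enum_val l).1 (enum_val l).2.
  have : enum_val l \in edges e by exact: enum_valP.
  by rewrite finset.in_set => /andP[].
have PiB : Pi *m B = 0.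
  apply/matrixP => i l; rewrite !mxE.
  under eq_bigr do rewrite mulrC.
  rewrite BtE !mxE -sumrB big1// => r _.
  by rewrite (comp_vec_connect r (connect1 (edge_e l))) subrr.
pose Q := 1%:M - B *m M.
have symQ : Q^T = Q by rewrite linearB /= trmx1 symBM.
have QB : Q *m B = 0 by rewrite mulmxBl mul1mx BMB subrr.
have BQ : B^T *m Q = 0.
  by apply: trmx_inj; rewrite trmx_mul trmxK symQ QB trmx0.
have Qconst i j k : connect e i j -> Q i k = Q j k.
  have step p q : e p q -> Q p k = Q q k.
    (* Columns of B exist only for p < q; symmetry of e covers the reverse order and irreflexivity
       excludes loops. *)
    wlog pq : p q / (p < q)%N => [wl epq|epq].
      have [pq|qp|/val_inj pq] := ltngtP p q; first exact: wl.
        by rewrite (wl q p)// sym_e.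
      by rewrite pq irr_e in epq.
    have pqE : (p, q) \in edges e by rewrite finset.in_set pq.
    pose l := enum_rank_in pqE (p, q).
    have lE : enum_val l = (p, q) by rewrite enum_rankK_in.
    have : (B^T *m Q) l k = 0 by rewrite BQ mxE.
    rewrite mxE; under eq_bigr do rewrite mxE.
    by rewrite (BtE (fun i => Q i k)) lE => /eqP; rewrite subr_eq0 => /eqP.
  move=> /connectP[p pe ->]; elim: p i pe => //= q p IH i /andP[iq qp].
  by rewrite (step _ _ iq); exact: IH.
have PiQ : Pi *m Q = Q.
  apply/matrixP => i k; rewrite mxE.
  under eq_bigr do rewrite mxE mulr_suml.
  rewrite exchange_big /= (bigD1 (fingraph.root e i)) ?(fingraph.roots_root csym)//=.
  rewrite [X in _ + X]big1 ?addr0 => [|r /andP[_ ri]]; last first.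
    rewrite big1// => j _; rewrite /b /comp_vec eq_sym (negPf ri).
    by rewrite !mul0r.
  transitivity (\sum_j (b (fingraph.root e i) j * b (fingraph.root e i) j) * Q i k).
    apply: eq_bigr => j _.
    have [rij|rij] := eqVneq (fingraph.root e j) (fingraph.root e i).
      have cij : connect e i j by rewrite -(fingraph.root_connect csym) rij.
      by rewrite (Qconst _ _ k cij) (comp_vec_connect _ cij).
    by rewrite /b /comp_vec (negPf rij) !(mul0r, mulr0).
  by rewrite -mulr_suml comp_vec_orthonormal ?(fingraph.roots_root csym)// eqxx mul1r.
have QPi : Q = Pi.
  by rewrite -PiQ mulmxBr mulmx1 mulmxA PiB mul0mx subr0.
move=> x h.
rewrite -(big_sub (fingraph.roots e)
  (fun r => (\sum_i b r i * x i) * (\sum_i b r i * h i))).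
have IE i j : (i == j)%:R = Pi i j + (B *m M) i j.
  by rewrite -QPi [Q]/(_ - _) !mxE subrK.
transitivity (\sum_i \sum_j (i == j)%:R * (h i * x j)).
  apply: eq_bigr => i _; rewrite (bigD1 i)//= eqxx mul1r big1 ?addr0.
    by rewrite mulrC.
  by move=> j /negPf; rewrite eq_sym => ->; rewrite mul0r.
under [LHS]eq_bigr => i _.
  under eq_bigr do rewrite IE mulrDl.
  rewrite big_split /=.
  over.
rewrite big_split /=; congr (_ + _).
  under eq_bigr do under eq_bigr do rewrite mxE mulr_suml.
  under eq_bigr do rewrite exchange_big /=.
  rewrite exchange_big /=; apply: eq_bigr => r _.
  rewrite mulrC mulr_suml; apply: eq_bigr => i _.
  by rewrite mulr_sumr; apply: eq_bigr => j _; rewrite mulrACA.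
under eq_bigr do under eq_bigr do rewrite mxE mulr_suml.
under eq_bigr do rewrite exchange_big /=.
rewrite exchange_big /=; apply: eq_bigr => l _.
rewrite -BtE mulrC mulr_suml; apply: eq_bigr => i _.
by rewrite mulr_sumr; apply: eq_bigr => j _; rewrite mulrACA.
Qed.

End Components.

Lemma sum_mxtens (V : nmodType) n d (F : 'I_(n * d) -> V) :
  \sum_j F j = \sum_i \sum_k F (mxtens_index (i, k)).
Proof.
rewrite pair_big /= (reindex (@mxtens_index n d)) /=; last first.
  exists (@mxtens_unindex n d) => j _; [exact: mxtens_indexK|exact: mxtens_unindexK].
by apply: eq_bigr => -[].
Qed.

Lemma edge_diffE (R : realType) n d (l : 'I_n * 'I_n) (x : 'cV[R]_(n * d)) k :
  (edge_diff R d l *m x) (mxtens_index (0, k)) 0 =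
  x (mxtens_index (l.1, k)) 0 - x (mxtens_index (l.2, k)) 0.
Proof.
rewrite mxE sum_mxtens.
transitivity (\sum_i ((i == l.1)%:R - (i == l.2)%:R) * x (mxtens_index (i, k)) 0).
  apply: eq_bigr => i _; rewrite (bigD1 k)//= big1 ?addr0 => [|k' k'k].
    by rewrite tensmxE !mxE !eqxx mulr1 (eq_sym i) (eq_sym i).
  by rewrite tensmxE !mxE [k == k']eq_sym (negPf k'k) mulr0 mul0r.
under eq_bigr do rewrite mulrBl.
rewrite sumrB (bigD1 l.1)//= eqxx mul1r big1 => [|i /negPf->]; last by rewrite mul0r.
rewrite (bigD1 l.2)//= eqxx mul1r big1 => [|i /negPf->]; last by rewrite mul0r.
by rewrite !addr0.
Qed.

Lemma enorm_edge_diff (R : realType) n d (l : 'I_n * 'I_n) (x : 'cV[R]_(n * d)) :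
  enorm (edge_diff R d l *m x) = Num.sqrt
    (\sum_k (x (mxtens_index (l.1, k)) 0 - x (mxtens_index (l.2, k)) 0) ^+ 2).
Proof.
rewrite /enorm (sum_mxtens (n := 1)) big_ord1; congr Num.sqrt.
by apply: eq_bigr => k _; rewrite edge_diffE.
Qed.

(** * Oracle inequality *)

Lemma objective_regularizer_convex (R : realType) n d1 d2 (e : rel 'I_n)
  (w : 'I_n -> 'I_n -> R) (gamma1 gamma2 : R) :
  (forall l, l \in edges e -> 0 <= w l.1 l.2) -> 0 <= gamma1 -> 0 <= gamma2 ->
  convex_fun (fun x : 'cV[R]_(n * (d1 * d2)) =>
    gamma1 * (\sum_(l in edges e)
                w l.1 l.2 * enorm (edge_diff R (d1 * d2) l *m x))
    + gamma2 * (\sum_(i < n) nuclear_norm (block_mat i x))).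
Proof.
move=> w0 g1 g2 s t x y s0 t0 _.
rewrite !mulrDr addrACA !(mulrCA _ gamma1) !(mulrCA _ gamma2) -!mulrDr.
apply: lerD; apply: ler_wpM2l => //.
  rewrite !mulr_sumr -big_split /=; apply: ler_sum => l le.
  rewrite !(mulrCA _ (w _ _)) -mulrDr ler_wpM2l ?w0//.
  by rewrite mulmxDr -!scalemxAr; exact: enorm_convex.
rewrite !mulr_sumr -big_split /=; apply: ler_sum => i _.
rewrite (_ : block_mat i _ = s *: block_mat i x + t *: block_mat i y).
  exact: nuclear_norm_convex.
by apply/matrixP => r c; rewrite !mxE.
Qed.

Lemma objectiveE (R : realType) n d1 d2 (e : rel 'I_n)
  (w : 'I_n -> 'I_n -> R) (gamma1 gamma2 : R) (a : 'cV[R]_(n * (d1 * d2))) :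
  objective e w gamma1 gamma2 a = fun x => 2^-1 * enorm (x - a) ^+ 2 +
   (gamma1 * (\sum_(l in edges e)
                w l.1 l.2 * enorm (edge_diff R (d1 * d2) l *m x))
    + gamma2 * (\sum_(i < n) nuclear_norm (block_mat i x))).
Proof. by apply/funext => x; rewrite /objective addrA. Qed.

Section NoiseDecomposition.
Context (R : realType) (n d : nat) (e : rel 'I_n).
Implicit Types x h : 'cV[R]_(n * d).

(** Coordinates of the projection of x onto blockwise functions constant on components, one for each
    component and position in the block. [range_coef] is M applied in the same blockwise manner. *)
Definition kernel_coef x (rk : {r in fingraph.roots e} * 'I_d) : R :=
  \sum_i comp_vec R e (val rk.1) i * x (mxtens_index (i, rk.2)) 0.

Definition range_coef (M : 'M[R]_(#|edges e|, n)) x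
    (lk : 'I_#|edges e| * 'I_d) : R :=
  \sum_i M lk.1 i * x (mxtens_index (i, lk.2)) 0.

Lemma dot_noise_le (M : 'M[R]_(#|edges e|, n)) x h (tau : R) :
  symmetric e ->
  (forall x h : 'I_n -> R, \sum_i x i * h i =
      \sum_(r : {r in fingraph.roots e})
        (\sum_i comp_vec R e (val r) i * x i) * (\sum_i comp_vec R e (val r) i * h i)
      + \sum_l (\sum_i M l i * x i) * (h (enum_val l).1 - h (enum_val l).2)) ->
  0 <= tau -> (forall lk, `|range_coef M x lk| <= tau) ->
  dot x h <= 2^-1 * (\sum_rk kernel_coef x rk ^+ 2) + 2^-1 * enorm h ^+ 2 +
    Num.sqrt d%:R * tau * (\sum_(l in edges e) enorm (edge_diff R d l *m h)).
Proof.
move=> sym_e proj tau0 Mx.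
have -> : dot x h = \sum_rk kernel_coef x rk * kernel_coef h rk +
    \sum_lk range_coef M x lk * (h (mxtens_index ((enum_val lk.1).1, lk.2)) 0
      - h (mxtens_index ((enum_val lk.1).2, lk.2)) 0).
  rewrite /dot sum_mxtens exchange_big /=.
  under eq_bigr => k _ do rewrite proj.
  rewrite big_split /=; congr (_ + _).
    by rewrite exchange_big pair_big.
  by rewrite exchange_big pair_big.
apply: lerD.
  rewrite enorm_sqr -mulrDr ler_pdivlMl// mulr_sumr.
  apply: (@le_trans _ _ (\sum_rk (kernel_coef x rk ^+ 2 + kernel_coef h rk ^+ 2))).
    apply: ler_sum => rk _.
    have := sqr_ge0 (kernel_coef x rk - kernel_coef h rk); rewrite sqrrB; lra.
  (* What remains is Bessel's inequality at each position k of the block. *)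
  rewrite big_split /= lerD2l /dot sum_mxtens exchange_big /=.
  rewrite -(pair_big xpredT xpredT (fun r k => kernel_coef h (r, k) ^+ 2)) /=.
  rewrite exchange_big /=; apply: ler_sum => k _.
  under [leRHS]eq_bigr do rewrite -expr2.
  apply: (orthonormal_bessel (b := fun r : {r in fingraph.roots e} =>
    comp_vec R e (val r)) _ (fun i => h (mxtens_index (i, k)) 0)) => r r'.
  by rewrite comp_vec_orthonormal//; exact: (valP r).
rewrite -(pair_big xpredT xpredT (fun l k => range_coef M x (l, k) *
  (h (mxtens_index ((enum_val l).1, k)) 0 - h (mxtens_index ((enum_val l).2, k)) 0))) /=.
rewrite mulr_sumr [leRHS]big_enum_val /=; apply: ler_sum => l _.
(* Cauchy-Schwarz over the d positions of one edge; d entries bounded by tau have norm at most sqrt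
   d * tau. *)
apply: le_trans (sum_mul_le_sqrt _ _) _; rewrite -enorm_edge_diff.
apply: ler_wpM2r; first exact: enorm_ge0.
have -> : Num.sqrt (\sum_k range_coef M x (l, k) ^+ 2) =
    enorm (\col_k range_coef M x (l, k)).
  by congr Num.sqrt; apply: eq_bigr => k _; rewrite mxE.
by apply: enorm_le_const => // k; rewrite mxE.
Qed.

End NoiseDecomposition.

Lemma estimation_error_le (R : realType) n d1 d2 (e : rel 'I_n)
  (w : 'I_n -> 'I_n -> R) (gamma1 gamma2 : R)
  (x0 eps xh : 'cV[R]_(n * (d1 * d2))) (S : R) :
  0 <= gamma1 -> 0 <= gamma2 -> (forall l, l \in edges e -> 1 / 2 <= w l.1 l.2) ->
  minimizer (objective e w gamma1 gamma2 (x0 + eps)) xh ->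
  dot eps (xh - x0) <= S + 2^-1 * enorm (xh - x0) ^+ 2 +
    gamma1 / 2 * (\sum_(l in edges e)
      enorm (edge_diff R (d1 * d2) l *m (xh - x0))) ->
  2^-1 * enorm (xh - x0) ^+ 2 <= S
    + gamma1 / 2 * (\sum_(l in edges e)
       (1 + 2 * w l.1 l.2) * enorm (edge_diff R (d1 * d2) l *m x0))
    + gamma2 * (\sum_(i < n) nuclear_norm (block_mat i x0)).
Proof.
move=> g1 g2 w2 xmin noise.
have w0 l : l \in edges e -> 0 <= w l.1 l.2 by move/w2; apply: le_trans; lra.
move: xmin; rewrite objectiveE => xmin.
have := prox_variational (objective_regularizer_convex w0 g1 g2) x0 xmin.
have -> : xh - (x0 + eps) = xh - x0 - eps by rewrite opprD addrA.
rewrite dotDl dotNl -enorm_sqr => opt.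
set Nh := \sum_(i < n) nuclear_norm (block_mat i xh) in opt.
have Nh0 : 0 <= gamma2 * Nh.
  by rewrite mulr_ge0// sumr_ge0// => i _; exact: nuclear_norm_ge0.
pose D (z : 'cV[R]_(n * (d1 * d2))) l := enorm (edge_diff R (d1 * d2) l *m z).
have edges_le : gamma1 / 2 * (\sum_(l in edges e) D (xh - x0) l)
    + gamma1 * (\sum_(l in edges e) w l.1 l.2 * D x0 l)
    - gamma1 * (\sum_(l in edges e) w l.1 l.2 * D xh l) <=
    gamma1 / 2 * (\sum_(l in edges e) (1 + 2 * w l.1 l.2) * D x0 l).
  rewrite -mulrA -mulrDr -mulrBr -mulrA; apply: ler_wpM2l => //.
  rewrite !mulr_sumr -big_split -sumrB /=; apply: ler_sum => l le.
  have : D (xh - x0) l <= D xh l + D x0 l.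
    rewrite /D mulmxBr; apply: le_trans (enormD _ _) _.
    by rewrite lerD2l -scaleN1r enormZ normrN1 mul1r.
  have : 2^-1 * D xh l <= w l.1 l.2 * D xh l.
    by apply: ler_wpM2r; [exact: enorm_ge0|have := w2 l le; lra].
  lra.
move: opt noise edges_le; rewrite /D; lra.
Qed.

(** * Tails of the two components of the noise *)

Section NoiseTails.
Context (R : realType) (disp : measure_display) (Omega : measurableType disp)
  (P : probability Omega R) (n d : nat) (X : 'I_(n * d) -> {RV P >-> R})
  (sigma : R) (indep_X : mutually_independent X)
  (sg_X : forall j, sub_gaussian (X j) sigma).

Let noise om : 'cV[R]_(n * d) := \col_j X j om.

Lemma sub_gaussian_blocks (C : 'I_n -> 'I_d -> R) :
  (\int[P]_w (expR (\sum_i \sum_k C i k * X (mxtens_index (i, k)) w))%:E <=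
   (expR (sigma ^+ 2 * (\sum_i \sum_k C i k ^+ 2) / 2))%:E)%E.
Proof.
have := sub_gaussian_linear
  (fun j => C (mxtens_unindex j).1 (mxtens_unindex j).2) indep_X sg_X.
rewrite sum_mxtens.
under eq_integral do rewrite sum_mxtens.
under eq_bigr do under eq_bigr do rewrite mxtens_indexK.
by under eq_integral do under eq_bigr do under eq_bigr do rewrite mxtens_indexK.
Qed.

(** A linear form in the kernel coefficients is one in the noise with the same sum of squared
    coefficients, by Parseval. *)
Lemma kernel_coef_mgf (e : rel 'I_n) (c : {r in fingraph.roots e} * 'I_d -> R) :
  symmetric e ->
  (\int[P]_w (expR (\sum_rk c rk * kernel_coef (noise w) rk))%:E <=
   (expR (sigma ^+ 2 * (\sum_rk c rk ^+ 2) / 2))%:E)%E.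
Proof.
move=> sym_e.
pose C i k := \sum_r c (r, k) * comp_vec R e (val r) i.
have -> : \sum_rk c rk ^+ 2 = \sum_i \sum_k C i k ^+ 2.
  rewrite exchange_big /=.
  under [RHS]eq_bigr => k _.
    rewrite (orthonormal_parseval (b := fun r : {r in fingraph.roots e} =>
      comp_vec R e (val r)) _ (fun r => c (r, k))); last first.
      by move=> r r'; rewrite comp_vec_orthonormal//; exact: (valP r).
    over.
  rewrite [RHS]exchange_big pair_big /=.
  by apply: eq_bigr => -[].
apply: le_trans (sub_gaussian_blocks C); rewrite le_eqVlt; apply/orP; left.
apply/eqP/eq_integral => w _; congr (expR _)%:E.
transitivity (\sum_r \sum_k c (r, k) * kernel_coef (noise w) (r, k)).
  by rewrite pair_big /=; apply: eq_bigr => -[].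
rewrite exchange_big [RHS]exchange_big /=; apply: eq_bigr => k _.
under eq_bigr do rewrite mulr_sumr.
rewrite exchange_big /=; apply: eq_bigr => i _.
by rewrite mulr_suml; apply: eq_bigr => r _; rewrite mxE mulrA.
Qed.

Lemma range_coef_mgf (e : rel 'I_n) (M : 'M[R]_(#|edges e|, n)) lk (K s : R) :
  \sum_i M lk.1 i ^+ 2 <= K ->
  (\int[P]_w (expR (s * range_coef M (noise w) lk))%:E <=
   (expR (sigma ^+ 2 * K * s ^+ 2 / 2))%:E)%E.
Proof.
move=> MK.
pose C i k := s * M lk.1 i * (k == lk.2)%:R.
apply: (@le_trans _ _
  (\int[P]_w (expR (\sum_i \sum_k C i k * X (mxtens_index (i, k)) w))%:E)%E).
  rewrite le_eqVlt; apply/orP; left; apply/eqP/eq_integral => w _.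
  congr (expR _)%:E; rewrite mulr_sumr; apply: eq_bigr => i _.
  rewrite (bigD1 lk.2)//= big1 ?addr0 => [|k /negPf kl]; last first.
    by rewrite /C kl mulr0 mul0r.
  by rewrite /C eqxx mulr1 mxE mulrA.
apply: le_trans (sub_gaussian_blocks C) _.
rewrite lee_fin ler_expR ler_pM2r// -mulrA ler_wpM2l ?sqr_ge0//.
rewrite mulrC; apply: le_trans (ler_wpM2l (sqr_ge0 s) MK).
rewrite mulr_sumr; apply: ler_sum => i _.
rewrite (bigD1 lk.2)//= big1 ?addr0 => [|k /negPf kl]; last first.
  by rewrite /C kl mulr0 expr0n.
by rewrite /C eqxx mulr1 exprMn.
Qed.

Lemma measurable_kernel_coef (e : rel 'I_n) rk :
  measurable_fun setT (fun w => @kernel_coef R n d e (noise w) rk).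
Proof.
apply: measurable_sum => i; apply: measurable_funM => //.
rewrite (_ : (fun _ => _) = X (mxtens_index (i, rk.2))) //.
by apply/funext => w; rewrite mxE.
Qed.

Lemma measurable_range_coef (e : rel 'I_n) (M : 'M[R]_(#|edges e|, n)) lk :
  measurable_fun setT (fun w => range_coef M (noise w) lk).
Proof.
apply: measurable_sum => i; apply: measurable_funM => //.
rewrite (_ : (fun _ => _) = X (mxtens_index (i, lk.2))) //.
by apply/funext => w; rewrite mxE.
Qed.

End NoiseTails.

(** The error inherits a Lipschitz dependence on the noise from [prox_nonexpansive]; sqrt of the
    dimension converts a coordinatewise bound to the Euclidean norm. *)
Lemma measurable_estimation_error (R : realType) (n d1 d2 : nat) (e : rel 'I_n)
  (w : 'I_n -> 'I_n -> R) (gamma1 gamma2 : R)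
  (disp : measure_display) (Omega : measurableType disp)
  (P : probability Omega R) (x0 : 'cV[R]_(n * (d1 * d2)))
  (eps : 'I_(n * (d1 * d2)) -> {RV P >-> R})
  (xhat : Omega -> 'cV[R]_(n * (d1 * d2))) :
  (forall l, l \in edges e -> 0 <= w l.1 l.2) -> 0 <= gamma1 -> 0 <= gamma2 ->
  (forall om, minimizer
       (objective e w gamma1 gamma2 (x0 + \col_k eps k om)) (xhat om)) ->
  measurable_fun setT (fun om => enorm (xhat om - x0)).
Proof.
move=> w0 g1 g2 xmin.
apply: (@measurable_fun_lipschitz _ _ _ _ (fun j => eps j : Omega -> R) _
  (Num.sqrt (n * (d1 * d2))%:R)) => // om om' b b0 epsb.
apply: le_trans (enorm_lip _ _ _) _.
have := xmin om; have := xmin om'; rewrite !objectiveE => m' m.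
apply: le_trans (prox_nonexpansive (objective_regularizer_convex w0 g1 g2) m m') _.
apply: enorm_le_const => // j; rewrite !mxE.
by rewrite opprD addrACA subrr add0r.
Qed.

Theorem theorem3p1 (R : realType) :
  exists c1 c2 : R, 0 < c1 /\ 0 < c2 /\
  forall (n d1 d2 : nat) (e : rel 'I_n) (w : 'I_n -> 'I_n -> R)
    (gamma1 gamma2 sigma : R)
    (disp : measure_display) (Omega : measurableType disp)
    (P : probability Omega R)
    (x0 : 'cV[R]_(n * (d1 * d2)))
    (eps : 'I_(n * (d1 * d2)) -> {RV P >-> R})
    (xhat : Omega -> 'cV[R]_(n * (d1 * d2))),
  let d := (d1 * d2)%N in
  let m := #|edges e| in
  let kappa0 := n_comp e predT in
  let D := @edge_diff R n d in
  (0 < d2)%N -> (d2 <= d1)%N ->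
  symmetric e -> irreflexive e -> (0 < m)%N ->
  (forall l, l \in edges e -> 0 < w l.1 l.2) ->
  (forall l, l \in edges e -> 1 / 2 <= w l.1 l.2) ->
  0 < gamma1 -> 0 < gamma2 -> 0 <= sigma ->
  mutually_independent eps ->
  (forall k, sub_gaussian (eps k) sigma) ->
  (forall om,
     minimizer
       (objective e w gamma1 gamma2 (x0 + \col_k eps k om)) (xhat om)) ->
  4 * sigma / sigma_min (incidence R e)
    * Num.sqrt (d%:R * ln (d * m)%N%:R) <= gamma1 ->
  ((1 - 2 / (d * m)%N%:R
      - 2 * expR (- (Num.sqrt (d ^ 3 * n)%N%:R / 2))
      - expR (- Num.min (c1 * ln (d * n)%N%:R)
                  (c2 * Num.sqrt (d%:R * kappa0%:R * ln (d * n)%N%:R))))%:E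
   <= P [set om |
        ((1 / (2 * d%:R * n%:R)) * enorm (xhat om - x0) ^+ 2
        <= sigma ^+ 2
             * (kappa0%:R / n%:R
                + Num.sqrt (kappa0%:R * ln (d * n)%N%:R / (d%:R * n%:R ^+ 2)))
           + gamma1 / (2 * d%:R * n%:R)
             * (\sum_(l in edges e)
                  (1 + 2 * w l.1 l.2) * enorm (D l *m x0))
           + gamma2
             * (sigma / n%:R `^ (1 / 4)
                + 1 / (d%:R * n%:R)
                  * (\sum_(i < n) nuclear_norm (block_mat i x0))))%R])%E.
Proof.
(* The tail exp(-t / 2) below dictates 1 / 2; as a minimum is at most its second argument, any
   positive first constant serves. *)
exists 1, (1 / 2); split; first by []; split; first by rewrite divr_gt0.
move=> n d1 d2 e w gamma1 gamma2 sigma disp Omega P x0 eps xhat d m kappa0 D.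
move=> d2_gt0 d21 sym_e irr_e m_gt0 w_gt0 w2 g1 g2 sg0 indep sg xmin gamma_le.
have [M Mle proj] := @incidence_projection R n e sym_e irr_e.
have d_gt0 : (0 < d)%N by rewrite muln_gt0 d2_gt0 (leq_trans d2_gt0 d21).
have n_gt0 : (0 < n)%N.
  by case/card_gt0P : m_gt0 => -[[i i_lt] _] _; apply: leq_trans i_lt.
have dR : 0 < d%:R :> R by rewrite ltr0n.
have nR : 0 < n%:R :> R by rewrite ltr0n.
have dm_gt0 : (0 < d * m)%N by rewrite muln_gt0 d_gt0.
have dmR : 0 < (d * m)%N%:R :> R by rewrite ltr0n.
pose L : R := ln (d * m)%N%:R.
have L0 : 0 <= L by rewrite ln_ge0// ler1n.
have LN0 : 0 <= ln (d * n)%N%:R :> R by rewrite ln_ge0// ler1n muln_gt0 d_gt0.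
have sd0 : 0 < Num.sqrt d%:R :> R by rewrite sqrtr_gt0.
pose t : R := Num.sqrt (d%:R * kappa0%:R * ln (d * n)%N%:R).
have t0 : 0 <= t by exact: sqrtr_ge0.
pose noise om : 'cV[R]_(n * d) := \col_k eps k om.
pose J := ({r in fingraph.roots e} * 'I_d)%type.
have JE : #|{: J}| = (d * kappa0)%N.
  rewrite card_prod card_ord mulnC card_sig; congr (_ * _)%N.
  by apply: eq_card => r; rewrite !inE andbT.
pose Bad1 := [set om | 2 * sigma ^+ 2 * ((d * kappa0)%N%:R + t) <
  \sum_rk kernel_coef (e := e) (noise om) rk ^+ 2].
have Bad1_le : (P Bad1 <= (expR (- (t / 2)))%:E)%E.
  rewrite /Bad1 -JE; apply: chi_square_tail => //.
    by move=> rk; exact: measurable_kernel_coef.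
  by move=> c; exact: kernel_coef_mgf.
have mBad1 : measurable Bad1.
  apply: measurable_gt; apply: measurable_sum => rk; apply: measurable_funX.
  exact: measurable_kernel_coef.
(* Chosen so that sqrt d * tau = gamma1 / 2. The lower bound on gamma1 then gives tau^2 >= 4 sigma^2
   K L, the condition of [sub_gaussian_tail]. *)
pose tau := gamma1 / (2 * Num.sqrt d%:R).
have tau0 : 0 < tau by rewrite divr_gt0// mulr_gt0.
pose K := (sigma_min (incidence R e)) ^- 2.
have tauK : 4 * (sigma ^+ 2 * K) * L <= tau ^+ 2.
  rewrite /tau expr_div_n exprMn sqr_sqrtr ?ler0n// ler_pdivlMr ?mulr_gt0//.
  have smin0 := sigma_min_ge0 (incidence R e).
  apply: le_trans (_ : (4 * sigma / sigma_min (incidence R e)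
    * Num.sqrt (d%:R * L)) ^+ 2 <= _); last first.
    by rewrite lerXn2r ?nnegrE ?(ltW g1)// !mulr_ge0// ?invr_ge0.
  rewrite exprMn sqr_sqrtr; last by rewrite mulr_ge0// ler0n.
  rewrite expr_div_n exprMn -/K.
  rewrite le_eqVlt; apply/orP; left; apply/eqP; ring.
pose Bad2 := [set om | exists lk, tau < `|range_coef M (noise om) lk|].
have [mBad2 Bad2_le] : measurable Bad2 /\ (P Bad2 <= (2 / (d * m)%N%:R)%:E)%E.
  (* Union over the d m coordinates, each with tail 2 exp(-2 L) = 2 / (d m)^2. *)
  have -> : 2 / (d * m)%N%:R = #|{: 'I_#|edges e| * 'I_d}|%:R * (2 * expR (- (2 * L))) :> R.
    rewrite card_prod !card_ord -/m (mulnC m) expRN [2 * L]mulrC expRM_natr.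
    rewrite lnK ?posrE//; move: ((d * m)%N%:R : R) dmR => q q0.
    by field; rewrite gt_eqF.
  apply: union_bound => lk.
    apply: measurable_gt; apply: measurableT_comp => //.
    exact: measurable_range_coef.
  apply: (sub_gaussian_tail (v := sigma ^+ 2 * K)) => //.
    exact: measurable_range_coef.
  by move=> s; apply: range_coef_mgf => //; exact: Mle.
set Goal := [set om | _].
have mGoal : measurable Goal.
  apply: measurable_le; apply: measurable_funM => //; apply: measurable_funX.
  apply: (measurable_estimation_error (P := P) (w := w) (gamma1 := gamma1)
    (gamma2 := gamma2) (e := e) (eps := eps)) => //; try exact: ltW.
  by move=> l /w_gt0/ltW.
have sub : ~` (Bad1 `|` Bad2) `<=` Goal.
  move=> om; rewrite setCU /Bad1 /Bad2 => -[/= /negP nb1 nb2].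
  set h := xhat om - x0.
  have tauE : Num.sqrt d%:R * tau = gamma1 / 2.
    by rewrite /tau; field; rewrite gt_eqF.
  have := @dot_noise_le R n d e M (noise om) h tau sym_e proj (ltW tau0).
  move=> /(_ _)/wrap[lk|dot_le].
    by rewrite leNgt; apply/negP => lk_tau; apply: nb2; exists lk.
  have := @estimation_error_le R n d1 d2 e w gamma1 gamma2 x0 (noise om) (xhat om)
    (sigma ^+ 2 * ((d * kappa0)%N%:R + t)) (ltW g1) (ltW g2) w2 (xmin om).
  move=> /(_ _)/wrap[|err_le].
    apply: le_trans dot_le _; rewrite tauE !lerD2r.
    by move: nb1; rewrite -leNgt; lra.
  (* After division by d n, the fluctuation t of the chi-square bound is exactly the square-root
     term of the claim. *)
  have tE : Num.sqrt (kappa0%:R * ln (d * n)%N%:R / (d%:R * n%:R ^+ 2)) =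
      t / (d%:R * n%:R).
    rewrite (_ : _ / _ = d%:R * kappa0%:R * ln (d * n)%N%:R *
      (d%:R * n%:R)^-1 ^+ 2); last by field; rewrite !gt_eqF.
    by rewrite sqrtrM ?mulr_ge0 ?ler0n// sqrtr_sqr ger0_norm.
  have slack : 0 <= gamma2 * (sigma / n%:R `^ (1 / 4)).
    by rewrite mulr_ge0 ?(ltW g2)// divr_ge0 ?powR_ge0.
  rewrite /Goal /= tE -/h.
  have dn0 : 0 < (d%:R * n%:R)^-1 :> R by rewrite invr_gt0 mulr_gt0.
  move: err_le; rewrite -(ler_pM2l dn0) -/h -/d natrM => err_le.
  set N0 := \sum_(i < n) _ in err_le *; set E0 := \sum_(l in _) _ in err_le *.
  apply: (@le_trans _ _ ((d%:R * n%:R)^-1 * (2^-1 * enorm h ^+ 2))).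
    by rewrite le_eqVlt; apply/orP; left; apply/eqP; field; rewrite !gt_eqF.
  apply: le_trans err_le _.
  (* The claimed bound minus the one obtained equals the nonnegative quantity in [slack]. *)
  rewrite -subr_ge0; apply: le_trans slack _.
  rewrite le_eqVlt; apply/orP; left; apply/eqP.
  by field; rewrite !gt_eqF// powR_gt0.
have mBad : measurable (Bad1 `|` Bad2) by exact: measurableU.
apply: (@le_trans _ _ (P (~` (Bad1 `|` Bad2)))); last first.
  by apply: le_measure; rewrite ?inE//; exact: measurableC.
rewrite probability_setC//.
have BadU : (P (Bad1 `|` Bad2) <= (expR (- (t / 2)) + 2 / (d * m)%N%:R)%:E)%E.
  by apply: le_trans; [exact: measureU2|rewrite EFinD; exact: leeD].
apply: (@le_trans _ _ (1 - (expR (- (t / 2)) + 2 / (d * m)%N%:R)%:E)%E); last first.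
  by rewrite leeB.
rewrite -EFinB lee_fin.
have tmin : expR (- (t / 2)) <= expR (- Num.min (1 * ln (d * n)%N%:R) (1 / 2 * t)).
  by rewrite ler_expR lerN2 ge_min; apply/orP; right; lra.
have := expR_ge0 (- (Num.sqrt (d ^ 3 * n)%N%:R / 2) : R).
move: tmin; rewrite -/t; lra.
Qed.
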